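(* $$Q_4 = Q_3 + Q_3 s_3 Q_3 + Q_3 s_3^{-1} Q_3 + Q_3 s_3 s_2^{-1} s_3 Q_3 + R w_0 + R w_0^{-1},$$ where $w_0 = s_3 s_2 s_1^2 s_2 s_3$.
   Context: $R=\mathbb{Z}[a^{\pm1},b^{\pm1},c^{\pm1}]$. $B_n$ is the braid group with Artin generators $s_1,\dots,s_{n-1}$. For $n\ge 3$, $Q_n$ is the quotient of $RB_n$ by the relations $(s_1-a)(s_1-b)(s_1-c)=0$ and $$s_1^{-1}s_2s_1 = s_1 s_2 s_1^{-1} - a^{-1} s_1 s_2 + a s_1 s_2^{-1} + a s_1^{-1}s_2 - a^3 s_1^{-1} s_2^{-1}+ a^{-1} s_2 s_1 - a s_2 s_1^{-1} - a s_2^{-1} s_1 + a^3 s_2^{-1}s_1^{-1} + a^2 s_1^{-1} s_2^{-1} s_1- a^2 s_1 s_2^{-1} s_1^{-1}.$$ Inside $Q_4$, $Q_3$ denotes the subalgebra generated by $s_1,s_2$; $Q_3 y Q_3$ denotes the $R$-span of the products $xyz$ with $x,z\in Q_3$. *)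

(* Defs.v *)
From HB Require Import structures.
From mathcomp Require Import all_boot all_order all_algebra.
From mathcomp Require Import finmap ring.
From mathcomp Require Import boolp classical_sets.
From mathcomp.multinomials Require Import mpoly.
From mathcomp.multinomials Require Import monalg.

Set Implicit Arguments.
Unset Strict Implicit.
Unset Printing Implicit Defensive.

Import GRing.Theory.

Local Open Scope fset_scope.
Local Open Scope classical_set_scope.
Local Open Scope ring_scope.
Local Open Scope quotient_scope.

(* Z[a^+-1, b^+-1, c^+-1], realised as the localisation of Z[a, b, c] at abc  *)
(* inside the fraction field.                                                 *)

Notation Zabc := (mpoly 3 int).

Definition Zabc_var (i : 'I_3) : Zabc := mpolyX int (mnm1 i).

Definition Zabc_abc : Zabc := \prod_(i < 3) Zabc_var i.

Definition laurent_pred : {pred {fraction Zabc}} :=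
  fun x => `[< exists p k, x = tofrac p / tofrac Zabc_abc ^+ k >].

Lemma Zabc_var_neq0 i : Zabc_var i != 0.
Proof.
by apply/eqP => /(congr1 (mpoly.mcoeff (mnm1 i)))/eqP; rewrite mcoeffX eqxx mpoly.mcoeff0.
Qed.

Lemma Zabc_abc_neq0 : tofrac Zabc_abc != 0 :> {fraction Zabc}.
Proof. by rewrite tofrac_eq0; apply/prodf_neq0 => i _; exact: Zabc_var_neq0. Qed.

Lemma laurent_predP x :
  reflect (exists p k, x = tofrac p / tofrac Zabc_abc ^+ k)
          (x \in laurent_pred).
Proof. exact: asboolP. Qed.

Fact laurent_subring_closed : subring_closed laurent_pred.
Proof.
have nz k : tofrac Zabc_abc ^+ k != 0 by rewrite expf_neq0 // Zabc_abc_neq0.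
split.
- by apply/laurent_predP; exists 1, 0%N; rewrite expr0 divr1 tofrac1.
- move=> _ _ /laurent_predP[p [k ->]] /laurent_predP[q [l ->]].
  apply/laurent_predP.
  exists (p * Zabc_abc ^+ l - q * Zabc_abc ^+ k), (k + l)%N.
  by rewrite tofracB !tofracM !tofracXn exprD -mulNr addf_div // mulNr.
- move=> _ _ /laurent_predP[p [k ->]] /laurent_predP[q [l ->]].
  apply/laurent_predP; exists (p * q), (k + l)%N.
  by rewrite tofracM exprD mulf_div.
Qed.
HB.instance Definition _ :=
  GRing.isSubringClosed.Build {fraction Zabc} laurent_pred
    laurent_subring_closed.

Record laurent := Laurent
  { laurent_val :> {fraction Zabc}; _ : laurent_val \in laurent_pred }.
HB.instance Definition _ := [isSub for laurent_val].
HB.instance Definition _ := [Choice of laurent by <:].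
HB.instance Definition _ := [SubChoice_isSubComNzRing of laurent by <:].


Section LaurentUnit.
Implicit Types x y : laurent.

Definition laurent_unit : {pred laurent} :=
  fun x => (val x != 0) && ((val x)^-1 \in laurent_pred).

Definition laurent_inv x : laurent :=
  if x \in laurent_unit then insubd x (val x)^-1 else x.

Fact laurent_mulVx : {in laurent_unit, left_inverse 1 laurent_inv *%R}.
Proof.
move=> x ux; apply: val_inj; rewrite /= /laurent_inv ux /insubd.
by case/andP: ux => x0 vx; rewrite insubT /= mulVf.
Qed.

Fact laurent_unitPl x y : y * x = 1 -> laurent_unit x.
Proof.
move=> /(congr1 val) /= yx.
have x0 : val x != 0.
  by apply/eqP => x0; move/eqP: yx; rewrite x0 mulr0 eq_sym oner_eq0.
apply/andP; split=> //.
have -> : (val x)^-1 = val y by apply: (mulIf x0); rewrite mulVf.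
exact: valP.
Qed.

Fact laurent_inv_out : {in [predC laurent_unit], laurent_inv =1 id}.
Proof. by move=> x /negbTE ux; rewrite /laurent_inv ux. Qed.

End LaurentUnit.

HB.instance Definition _ := GRing.ComNzRing_hasMulInverse.Build laurent
  laurent_mulVx laurent_unitPl laurent_inv_out.

Fact laurent_var_subproof i : tofrac (Zabc_var i) \in laurent_pred.
Proof.
by apply/laurent_predP; exists (Zabc_var i), 0%N; rewrite expr0 divr1.
Qed.

Definition laurent_var (i : 'I_3) : laurent := Laurent (laurent_var_subproof i).

Lemma laurent_var_unit i : laurent_var i \is a GRing.unit.
Proof.
pose q : Zabc := \prod_(j < 3 | j != i) Zabc_var j.
have qP : tofrac q / tofrac Zabc_abc \in laurent_pred.
  by apply/laurent_predP; exists q, 1%N; rewrite expr1.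
have qx : Laurent qP * laurent_var i = 1.
  apply: val_inj => /=.
  rewrite mulrAC -tofracM mulrC (_ : q * _ = Zabc_abc) ?mulVf ?Zabc_abc_neq0//.
  by rewrite mulrC /Zabc_abc (bigD1 i).
by apply/unitrP; exists (Laurent qP); split=> //; rewrite mulrC.
Qed.


(* Braid words: the letter (i, true) stands for the Artin generator s_(i+1)   *)
(* and (i, false) for its inverse.                                            *)

Section BraidGroup.
Variable n : nat.

Notation letter := ('I_n.-1 * bool)%type.
Implicit Types u v w : seq letter.

Inductive braid_eq : seq letter -> seq letter -> Prop :=
| braid_eq_refl u : braid_eq u u
| braid_eq_sym u v : braid_eq u v -> braid_eq v u
| braid_eq_trans u v w : braid_eq u v -> braid_eq v w -> braid_eq u w
| braid_eq_cat u u' v v' :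
    braid_eq u u' -> braid_eq v v' -> braid_eq (u ++ v) (u' ++ v')
| braid_eq_inv i e : braid_eq [:: (i, e); (i, ~~ e)] [::]
| braid_eq_far (i j : 'I_n.-1) : (i.+1 < j)%N ->
    braid_eq [:: (i, true); (j, true)] [:: (j, true); (i, true)]
| braid_eq_near (i j : 'I_n.-1) : i.+1 = j :> nat ->
    braid_eq [:: (i, true); (j, true); (i, true)]
             [:: (j, true); (i, true); (j, true)].

Definition braid_rel : rel (seq letter) := fun u v => `[< braid_eq u v >].

Fact braid_rel_equiv : equiv_class_of braid_rel.
Proof.
split=> [u|u v|v u w]; first by apply/asboolP; exact: braid_eq_refl.
- by apply/asboolP/asboolP; exact: braid_eq_sym.
- move=> /asboolP uv /asboolP vw; apply/asboolP.
  exact: braid_eq_trans uv vw.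
Qed.
Canonical braid_equiv := EquivRelPack braid_rel_equiv.
Canonical braid_encModRel := defaultEncModRel braid_rel.

Definition braid := {eq_quot braid_rel}.
HB.instance Definition _ := EqQuotient.on braid.
HB.instance Definition _ := Choice.on braid.

Lemma braid_piP u v : \pi_braid u = \pi_braid v <-> braid_eq u v.
Proof.
split=> [/eqP|uv]; first by rewrite piE => /asboolP.
by apply/eqP; rewrite piE; apply/asboolP.
Qed.

Lemma braid_reprP u : braid_eq (repr (\pi_braid u)) u.
Proof. by apply/braid_piP; rewrite reprK. Qed.

Definition word_inv u : seq letter := rev [seq (x.1, ~~ x.2) | x <- u].

Lemma word_inv_cat u v : word_inv (u ++ v) = word_inv v ++ word_inv u.
Proof. by rewrite /word_inv map_cat rev_cat. Qed.

Lemma word_invK : involutive word_inv.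
Proof.
move=> u; rewrite /word_inv map_rev revK -map_comp -[RHS]map_id.
by apply: eq_map => -[i e] /=; rewrite negbK.
Qed.

Lemma word_mulVw u : braid_eq (word_inv u ++ u) [::].
Proof.
elim: u => [|[i e] u IHu]; first exact: braid_eq_refl.
rewrite -[(i, e) :: u]cat1s word_inv_cat -catA.
apply: braid_eq_trans IHu; apply: braid_eq_cat; first exact: braid_eq_refl.
rewrite catA -[X in braid_eq _ X]cat0s.
apply: braid_eq_cat; last exact: braid_eq_refl.
by have := braid_eq_inv i (~~ e); rewrite negbK.
Qed.

Lemma word_inv_eq u v : braid_eq u v -> braid_eq (word_inv u) (word_inv v).
Proof.
move=> uv.
have vv : braid_eq (v ++ word_inv v) [::].
  by rewrite -{1}[v]word_invK; exact: word_mulVw.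
have h1 : braid_eq (word_inv u) (word_inv u ++ (v ++ word_inv v)).
  rewrite -{1}[word_inv u]cats0; apply: braid_eq_cat.
    exact: braid_eq_refl.
  exact: braid_eq_sym.
apply: braid_eq_trans h1 _; rewrite catA -[X in braid_eq _ X]cat0s.
apply: braid_eq_cat; last exact: braid_eq_refl.
apply: braid_eq_trans (word_mulVw u); apply: braid_eq_cat.
  exact: braid_eq_refl.
exact: braid_eq_sym.
Qed.

Definition braid_one : braid := \pi_braid [::].
Definition braid_mul (x y : braid) : braid := \pi_braid (repr x ++ repr y).
Definition braid_inv (x : braid) : braid := \pi_braid (word_inv (repr x)).

Lemma braid_piM u v : \pi_braid (u ++ v) = braid_mul (\pi_braid u) (\pi_braid v).
Proof.
apply/braid_piP/braid_eq_sym.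
by apply: braid_eq_cat; apply: braid_reprP.
Qed.

Lemma braid_piV u : \pi_braid (word_inv u) = braid_inv (\pi_braid u).
Proof. by apply/braid_piP/word_inv_eq/braid_eq_sym/braid_reprP. Qed.

Fact braid_mulA : associative braid_mul.
Proof.
elim/quotW=> u; elim/quotW=> v; elim/quotW=> w.
by rewrite -(braid_piM v w) -(braid_piM u v) -!(braid_piM _ w) -braid_piM catA.
Qed.

Fact braid_mul1 : left_id braid_one braid_mul.
Proof. by elim/quotW=> u; rewrite /braid_one -(braid_piM [::] u). Qed.

Fact braid_mulr1 : right_id braid_one braid_mul.
Proof. by elim/quotW=> u; rewrite /braid_one -(braid_piM u [::]) cats0. Qed.

Fact braid_mulV : left_inverse braid_one braid_inv braid_mul.
Proof.
elim/quotW=> u; rewrite -(braid_piV u) -(braid_piM _ u).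
exact/braid_piP/word_mulVw.
Qed.

Fact braid_mulrV : right_inverse braid_one braid_inv braid_mul.
Proof.
elim/quotW=> u; rewrite -(braid_piV u) -(braid_piM u); apply/braid_piP.
by rewrite -{1}[u]word_invK; apply: word_mulVw.
Qed.

HB.instance Definition _ := isGroup.Build braid
  braid_mulA braid_mul1 braid_mulr1 braid_mulV braid_mulrV.

(* s_i for 1 <= i <= n - 1; the value is 1 for an index out of range.         *)
Definition artin (i : nat) : braid :=
  if i is j.+1 then
    if insub j is Some k then \pi_braid [:: (k, true)] else 1%g
  else 1%g.

End BraidGroup.

(* The ring structure of {malg R[G]} in monalg requires a monoid in which     *)
(* x * y = 1 forces x = y = 1, so the convolution product is redone here.     *)

Definition galg (R : nzRingType) (G : groupType) := {malg R[G]}.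

Section GroupAlgebra.
Variables (R : comNzRingType) (G : groupType).

Notation RG := (galg R G).
HB.instance Definition _ := GRing.Lmodule.on RG.
Implicit Types g : {malg R[G]}.

Definition gbas (x : G) : RG := << x >>.

Definition gmul g1 g2 : {malg R[G]} :=
  \sum_(x <- msupp g1) \sum_(y <- msupp g2) << mcoeff x g1 * mcoeff y g2 *g (x * y)%g >>.

Lemma gmulEw (d1 d2 : {fset G}) g1 g2 :
    (msupp g1 `<=` d1)%fset -> (msupp g2 `<=` d2)%fset ->
  gmul g1 g2 = \sum_(x <- d1) \sum_(y <- d2) << mcoeff x g1 * mcoeff y g2 *g (x * y)%g >>.
Proof.
move=> le_d1 le_d2; rewrite /gmul (big_fset_incl _ le_d1) /=.
  apply/eq_bigr=> k1 _; apply/big_fset_incl => // k _ /mcoeff_outdom ->.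
  by rewrite mulr0 monalgU0.
move=> k _ /mcoeff_outdom g1k.
by rewrite big1 => // k' _; rewrite g1k mul0r monalgU0.
Qed.

Lemma gmul0g : left_zero 0 gmul.
Proof. by move=> g; rewrite /gmul msupp0 big_seq_fset0. Qed.

Lemma gmulg0 : right_zero 0 gmul.
Proof. by move=> g; rewrite /gmul exchange_big msupp0 big_seq_fset0. Qed.

Lemma gmulUU r1 r2 x1 x2 :
  gmul << r1 *g x1 >> << r2 *g x2 >> = << r1 * r2 *g (x1 * x2)%g >>.
Proof. by rewrite (gmulEw msuppU_le msuppU_le) !big_seq_fset1 !mcoeffUU. Qed.

Lemma gmulDl : left_distributive gmul +%R.
Proof.
move=> g1 g2 g.
rewrite [in RHS](gmulEw (fsubsetUl _ (msupp g2)) (fsubset_refl _)).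
rewrite [in RHS](gmulEw (fsubsetUr (msupp g1) _) (fsubset_refl _)).
rewrite (gmulEw (msuppD_le _ _) (fsubset_refl _)).
rewrite -big_split /=; apply/eq_bigr=> k1 _.
rewrite -big_split /=; apply/eq_bigr=> k2 _.
by rewrite mcoeffD mulrDl monalgUD.
Qed.

Lemma gmulDr : right_distributive gmul +%R.
Proof.
move=> g g1 g2.
rewrite [in RHS](gmulEw (fsubset_refl _) (fsubsetUl _ (msupp g2))).
rewrite [in RHS](gmulEw (fsubset_refl _) (fsubsetUr (msupp g1) _)).
rewrite (gmulEw (fsubset_refl _) (msuppD_le _ _)).
rewrite -big_split /=; apply/eq_bigr=> k1 _.
rewrite -big_split /=; apply/eq_bigr=> k2 _.
by rewrite mcoeffD mulrDr monalgUD.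
Qed.

Lemma gmul_suml (I : Type) (r : seq I) (F : I -> {malg R[G]}) g :
  gmul (\sum_(i <- r) F i) g = \sum_(i <- r) gmul (F i) g.
Proof. exact: (big_morph (gmul^~ g) (fun _ _ => gmulDl _ _ _) (gmul0g _)). Qed.

Lemma gmul_sumr (I : Type) (r : seq I) (F : I -> {malg R[G]}) g :
  gmul g (\sum_(i <- r) F i) = \sum_(i <- r) gmul g (F i).
Proof. exact: (big_morph (gmul g) (fun _ _ => gmulDr _ _ _) (gmulg0 _)). Qed.

Lemma gmul1g : left_id << 1%g >> gmul.
Proof.
move=> g; rewrite [in RHS](monalgE g) {1}(monalgE g) gmul_sumr.
by apply/eq_bigr=> x _; rewrite gmulUU mul1r mul1g.
Qed.

Lemma gmulg1 : right_id << 1%g >> gmul.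
Proof.
move=> g; rewrite [in RHS](monalgE g) {1}(monalgE g) gmul_suml.
by apply/eq_bigr=> x _; rewrite gmulUU mulr1 mulg1.
Qed.

Lemma gmulA : associative gmul.
Proof.
move=> g1 g2 g3; rewrite (monalgE g1) !gmul_suml; apply/eq_bigr=> x _.
rewrite (monalgE g2) gmul_suml !gmul_sumr gmul_suml; apply/eq_bigr=> y _.
rewrite (monalgE g3) !gmul_sumr; apply/eq_bigr=> z _.
by rewrite !gmulUU mulrA mulgA.
Qed.

Lemma gone_neq0 : << 1%g >> != 0 :> {malg R[G]}.
Proof. by rewrite monalgU_eq0 oner_eq0. Qed.

HB.instance Definition _ := GRing.Zmodule_isNzRing.Build RG
  gmulA gmul1g gmulg1 gmulDl gmulDr gone_neq0.

Lemma gmulUE r x : << r *g x >> = r *: << x >> :> {malg R[G]}.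
Proof.
by apply/malgP => y; rewrite mcoeffZ !mcoeffU mulr_natr.
Qed.

Lemma gscaleAl r (g1 g2 : RG) : r *: (g1 * g2) = (r *: g1) * g2.
Proof.
rewrite -[LHS]/(r *: gmul g1 g2) -[RHS]/(gmul (r *: g1) g2).
rewrite (gmulEw (msuppZ_le r g1) (fsubset_refl _)) scaler_sumr.
apply/eq_bigr=> x _; rewrite scaler_sumr; apply/eq_bigr=> y _.
by rewrite mcoeffZ gmulUE scalerA mulrA -gmulUE.
Qed.
HB.instance Definition _ := GRing.Lmodule_isLalgebra.Build R RG gscaleAl.

Lemma gscaleAr r (g1 g2 : RG) : r *: (g1 * g2) = g1 * (r *: g2).
Proof.
rewrite -[LHS]/(r *: gmul g1 g2) -[RHS]/(gmul g1 (r *: g2)).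
rewrite (gmulEw (fsubset_refl _) (msuppZ_le r g2)) scaler_sumr.
apply/eq_bigr=> x _; rewrite scaler_sumr; apply/eq_bigr=> y _.
by rewrite mcoeffZ mulrCA gmulUE scalerA -gmulUE.
Qed.
HB.instance Definition _ := GRing.Lalgebra_isAlgebra.Build R RG gscaleAr.

Lemma gbasM x y : gbas (x * y)%g = gbas x * gbas y.
Proof. by rewrite -[RHS]/(gmul _ _) gmulUU mulr1. Qed.

Lemma gbas1 : gbas 1%g = 1. Proof. by []. Qed.

Lemma galgE (g : RG) : g = \sum_(x <- msupp g) mcoeff x g *: gbas x.
Proof.
by rewrite [LHS]monalgE; apply/eq_bigr=> x _; rewrite gmulUE.
Qed.

Section Character.
Variable h : G -> R.
Hypothesis hM : {morph h : x y / (x * y)%g >-> x * y}.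
Hypothesis h1 : h 1%g = 1.

Definition gchar (g : RG) : R := mmap idfun h g.

Lemma gcharD : {morph gchar : g1 g2 / g1 + g2}.
Proof. exact: (raddfD (mmap (idfun : R -> R) h)). Qed.

Lemma gcharU r x : gchar << r *g x >> = r * h x.
Proof. exact: mmapU. Qed.

Lemma gchar_bas x : gchar (gbas x) = h x.
Proof. by rewrite gcharU mul1r. Qed.

Lemma gchar_sum (I : Type) (r : seq I) (F : I -> RG) :
  gchar (\sum_(i <- r) F i) = \sum_(i <- r) gchar (F i).
Proof. exact: (raddf_sum (mmap (idfun : R -> R) h)). Qed.

Lemma gcharZ r g : gchar (r *: (g : RG)) = r * gchar g.
Proof.
rewrite {1}[g]galgE scaler_sumr gchar_sum /gchar mmapE mulr_sumr.
by apply/eq_bigr=> x _; rewrite scalerA -gmulUE [LHS]gcharU mulrA.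
Qed.

Lemma gcharM : {morph gchar : g1 g2 / g1 * g2}.
Proof.
move=> g1 g2; rewrite -[X in gchar X]/(gmul g1 g2) /gmul gchar_sum.
rewrite /gchar [mmap _ _ g1]mmapE mulr_suml; apply/eq_bigr=> x _.
rewrite [LHS]gchar_sum [mmap _ _ g2]mmapE mulr_sumr; apply/eq_bigr=> y _.
by rewrite gcharU hM mulrACA.
Qed.

Lemma gchar1 : gchar 1 = 1.
Proof. by rewrite -gbas1 gchar_bas. Qed.

End Character.

End GroupAlgebra.
Arguments gbas {R G} x.

Section TwoSidedIdeal.
Variables (R : comNzRingType) (A : algType R) (S : set A).

Inductive in_ideal : A -> Prop :=
| in_ideal0 : in_ideal 0
| in_idealD x r y z : S r -> in_ideal z -> in_ideal (x * r * y + z).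

Definition ideal : {pred A} := fun x => `[< in_ideal x >].

Lemma in_ideal_add x y : in_ideal x -> in_ideal y -> in_ideal (x + y).
Proof.
elim=> [|u r v z Sr _ IHz] Iy; first by rewrite add0r.
by rewrite -addrA; apply: in_idealD => //; exact: IHz.
Qed.

Lemma in_ideal_mull a x : in_ideal x -> in_ideal (a * x).
Proof.
elim=> [|u r v z Sr _ IHz]; first by rewrite mulr0; exact: in_ideal0.
by rewrite mulrDr !mulrA; exact: in_idealD.
Qed.

Lemma in_ideal_mulr a x : in_ideal x -> in_ideal (x * a).
Proof.
elim=> [|u r v z Sr _ IHz]; first by rewrite mul0r; exact: in_ideal0.
by rewrite mulrDl -mulrA; exact: in_idealD.
Qed.

Lemma in_ideal_gen r : S r -> in_ideal r.
Proof.
move=> Sr; rewrite -[r]addr0 -[r in r + 0]mul1r -[1 * r]mulr1.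
by apply: in_idealD => //; exact: in_ideal0.
Qed.

Fact ideal_zmod_closed : zmod_closed ideal.
Proof.
split=> [|x y /asboolP Ix /asboolP Iy]; apply/asboolP; first exact: in_ideal0.
by apply: in_ideal_add => //; rewrite -mulN1r; exact: in_ideal_mull.
Qed.
HB.instance Definition _ := GRing.isZmodClosed.Build A ideal ideal_zmod_closed.

Definition quot_alg := Quotient.quot ideal.
HB.instance Definition _ := GRing.Zmodule.on quot_alg.

Definition qpi (x : A) : quot_alg := \pi_quot_alg x.

Lemma qpiP x y : qpi x = qpi y <-> in_ideal (x - y).
Proof.
split=> [/eqP|Ixy]; first by rewrite -Quotient.idealrBE => /asboolP.
by apply/eqP; rewrite -Quotient.idealrBE; exact/asboolP.
Qed.

Lemma qpiW (P : quot_alg -> Prop) : (forall x, P (qpi x)) -> forall x, P x.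
Proof. by move=> Pq x; rewrite -[x]reprK; exact: Pq. Qed.

Lemma qpiD x y : qpi (x + y) = qpi x + qpi y.
Proof. exact: Quotient.pi_add. Qed.

Lemma qpi0 : qpi 0 = 0.
Proof. by apply: (addrI (qpi 0)); rewrite -qpiD !addr0. Qed.

Lemma qpi_repr x : in_ideal (repr (qpi x) - x).
Proof. by apply/qpiP; rewrite {1}/qpi reprK. Qed.

Definition qmul (x y : quot_alg) : quot_alg := qpi (repr x * repr y).
Definition qscale (k : R) (x : quot_alg) : quot_alg := qpi (k *: repr x).

Lemma qpiM x y : qpi (x * y) = qmul (qpi x) (qpi y).
Proof.
apply/esym/qpiP.
have -> : repr (qpi x) * repr (qpi y) - x * y =
    (repr (qpi x) - x) * repr (qpi y) + x * (repr (qpi y) - y).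
  by rewrite mulrBl mulrBr addrA addrNK.
apply: in_ideal_add; [apply: in_ideal_mulr | apply: in_ideal_mull];
  exact: qpi_repr.
Qed.

Lemma qpiZ k x : qpi (k *: x) = qscale k (qpi x).
Proof.
apply/esym/qpiP; rewrite -scalerBr -mulr_algl.
exact/in_ideal_mull/qpi_repr.
Qed.

Fact qmulA : associative qmul.
Proof.
elim/qpiW=> x; elim/qpiW=> y; elim/qpiW=> z.
by rewrite -(qpiM y z) -(qpiM x y) -!(qpiM _ z) -qpiM mulrA.
Qed.

Fact qmul1 : left_id (qpi 1) qmul.
Proof. by elim/qpiW=> x; rewrite -qpiM mul1r. Qed.

Fact qmulr1 : right_id (qpi 1) qmul.
Proof. by elim/qpiW=> x; rewrite -qpiM mulr1. Qed.

Fact qmulDl : left_distributive qmul +%R.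
Proof.
elim/qpiW=> x; elim/qpiW=> y; elim/qpiW=> z.
by rewrite -(qpiD x y) -!(qpiM _ z) -qpiD mulrDl.
Qed.

Fact qmulDr : right_distributive qmul +%R.
Proof.
elim/qpiW=> x; elim/qpiW=> y; elim/qpiW=> z.
by rewrite -(qpiD y z) -!(qpiM x) -qpiD mulrDr.
Qed.

HB.instance Definition _ := GRing.Zmodule_isPzRing.Build quot_alg
  qmulA qmul1 qmulr1 qmulDl qmulDr.

Fact qscaleA k l x : qscale k (qscale l x) = qscale (k * l) x.
Proof. by elim/qpiW: x => x; rewrite -!qpiZ scalerA. Qed.

Fact qscale1 : left_id 1 qscale.
Proof. by elim/qpiW=> x; rewrite -qpiZ scale1r. Qed.

Fact qscaleDr : right_distributive qscale +%R.
Proof.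
by move=> k; elim/qpiW=> x; elim/qpiW=> y; rewrite -qpiD -!qpiZ -qpiD scalerDr.
Qed.

Fact qscaleDl x : {morph qscale^~ x : k l / k + l}.
Proof.
by elim/qpiW: x => x k l; rewrite -!qpiZ -qpiD scalerDl.
Qed.

HB.instance Definition _ := GRing.Zmodule_isLmodule.Build R quot_alg
  qscaleA qscale1 qscaleDr qscaleDl.

Lemma qscaleAl k (x y : quot_alg) : k *: (x * y) = (k *: x) * y.
Proof.
elim/qpiW: x => x; elim/qpiW: y => y.
rewrite -[LHS]/(qscale k (qmul (qpi x) (qpi y))).
rewrite -[RHS]/(qmul (qscale k (qpi x)) (qpi y)).
by rewrite -(qpiM x y) -(qpiZ k) -(qpiZ k x) -qpiM scalerAl.
Qed.

Lemma qscaleAr k (x y : quot_alg) : k *: (x * y) = x * (k *: y).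
Proof.
elim/qpiW: x => x; elim/qpiW: y => y.
rewrite -[LHS]/(qscale k (qmul (qpi x) (qpi y))).
rewrite -[RHS]/(qmul (qpi x) (qscale k (qpi y))).
by rewrite -(qpiM x y) -(qpiZ k) -(qpiZ k y) -qpiM scalerAr.
Qed.

End TwoSidedIdeal.

Section QAlgebra.
Variables (R : comUnitRingType) (a b c : R).

(* The relations of Q_n, as elements to be sent to 0; t1 and t2 stand for the *)
(* inverses of s1 and s2.                                                     *)

Definition cubic_relator (A : algType R) (s1 : A) : A :=
  (s1 - a%:A) * (s1 - b%:A) * (s1 - c%:A).

Definition Q_relator (A : algType R) (s1 s2 t1 t2 : A) : A :=
  t1 * s2 * s1 -
  (s1 * s2 * t1 - a^-1 *: (s1 * s2) + a *: (s1 * t2)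
   + a *: (t1 * s2) - a ^+ 3 *: (t1 * t2) + a^-1 *: (s2 * s1)
   - a *: (s2 * t1) - a *: (t2 * s1) + a ^+ 3 *: (t2 * t1)
   + a ^+ 2 *: (t1 * t2 * s1) - a ^+ 2 *: (s1 * t2 * t1)).

Lemma relator_char (A : algType R) (chi : A -> R) (s1 s2 t1 t2 : A) :
    {morph chi : x y / x + y} -> {morph chi : x y / x * y} ->
    (forall k x, chi (k *: x) = k * chi x) -> chi 1 = 1 ->
    chi s1 = a -> chi s2 = a -> chi t1 = a^-1 -> chi t2 = a^-1 ->
  chi (cubic_relator s1) = 0 /\ chi (Q_relator s1 s2 t1 t2) = 0.
Proof.
move=> chiD chiM chiZ chi1 s1E s2E t1E t2E.
have chiN x : chi (- x) = - chi x by rewrite -scaleN1r chiZ mulN1r.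
split; first by rewrite !chiM chiD chiN chiZ chi1 s1E mulr1 subrr !mul0r.
rewrite /Q_relator !(chiD, chiN, chiZ, chiM) s1E s2E t1E t2E.
by move: (a^-1) => d; ring.
Qed.

Lemma relator_morph (A B : algType R) (f : A -> B) (s1 s2 t1 t2 : A) :
    {morph f : x y / x + y} -> {morph f : x y / x * y} ->
    (forall k x, f (k *: x) = k *: f x) -> f 1 = 1 ->
  f (cubic_relator s1) = cubic_relator (f s1) /\
  f (Q_relator s1 s2 t1 t2) = Q_relator (f s1) (f s2) (f t1) (f t2).
Proof.
move=> fD fM fZ f1.
have fN x : f (- x) = - f x by rewrite -scaleN1r fZ scaleN1r.
split; first by rewrite /cubic_relator !(fM, fD, fN, fZ, f1).
by rewrite /Q_relator !(fD, fN, fZ, fM).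
Qed.

Variable n : nat.

Notation RB := (galg R (braid n)).

Definition Q_relations : set RB :=
  let s i : RB := gbas (artin n i) in
  let t i : RB := gbas (artin n i)^-1%g in
  [set cubic_relator (s 1); Q_relator (s 1) (s 2) (t 1) (t 2)].

Hypotheses (a_unit : a \is a GRing.unit) (n_ge3 : (2 < n)%N).

(* The two hypotheses are only used to prove 1 <> 0, which algType requires.  *)
Definition Qalg of a \is a GRing.unit & (2 < n)%N := quot_alg Q_relations.
Local Notation Q := (Qalg a_unit n_ge3).
HB.instance Definition _ := GRing.Lmodule.on Q.
HB.instance Definition _ := GRing.PzRing.on Q.

(* Sending every s_i to a defines a character of B_n that kills the relations,*)
(* hence 1 <> 0 in Q_n.                                                       *)
Definition word_char (u : seq ('I_n.-1 * bool)) : R :=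
  \prod_(x <- u) (if x.2 then a else a^-1).

Lemma word_char_eq u v : braid_eq u v -> word_char u = word_char v.
Proof.
elim=> // {u v}.
- by move=> u v w _ -> _ ->.
- by move=> u u' v v' _ eu _ ev; rewrite /word_char !big_cat /= -!/(word_char _) eu ev.
- move=> i e; rewrite /word_char !big_cons !big_nil /= mulr1.
  by case: e; rewrite /= ?mulrV ?mulVr ?a_unit.
- by move=> i j _; rewrite /word_char !big_cons.
- by move=> i j _; rewrite /word_char !big_cons.
Qed.

Definition braid_char (x : braid n) : R := word_char (repr x).

Lemma braid_charE u : braid_char (\pi_(braid n) u) = word_char u.
Proof. exact/word_char_eq/braid_reprP. Qed.

Lemma braid_charM : {morph braid_char : x y / (x * y)%g >-> x * y}.
Proof. by move=> x y; rewrite [LHS]braid_charE /word_char big_cat. Qed.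

Lemma braid_char1 : braid_char 1%g = 1.
Proof. by rewrite [LHS]braid_charE /word_char big_nil. Qed.

Lemma braid_char_artin i : (0 < i < n)%N -> braid_char (artin n i) = a.
Proof.
case: i => // j lt_jn.
have lt_j : (j < n.-1)%N by rewrite -ltnS prednK // (leq_trans _ lt_jn).
by rewrite /artin insubT braid_charE /word_char big_cons big_nil mulr1.
Qed.

Lemma braid_charV x : braid_char x^-1%g = (braid_char x)^-1.
Proof.
have xV : braid_char x^-1%g * braid_char x = 1.
  by rewrite -braid_charM mulVg braid_char1.
have ux : braid_char x \is a GRing.unit.
  by apply/unitrP; exists (braid_char x^-1%g); split=> //; rewrite mulrC.
by apply: (mulIr ux); rewrite xV mulVr.
Qed.

Notation chi := (gchar braid_char).

Lemma chi_relations r : Q_relations r -> chi r = 0.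
Proof.
have s1E : chi (gbas (artin n 1)) = a.
  by rewrite gchar_bas braid_char_artin ?(ltn_trans _ n_ge3).
have s2E : chi (gbas (artin n 2)) = a by rewrite gchar_bas braid_char_artin.
have t1E : chi (gbas (artin n 1)^-1%g) = a^-1.
  by rewrite gchar_bas braid_charV -gchar_bas s1E.
have t2E : chi (gbas (artin n 2)^-1%g) = a^-1.
  by rewrite gchar_bas braid_charV -gchar_bas s2E.
have [r1 r2] := relator_char (gcharD braid_char) (gcharM braid_charM)
  (gcharZ braid_char) (gchar1 braid_char1) s1E s2E t1E t2E.
by case=> ->.
Qed.

Lemma chi_ideal x : in_ideal Q_relations x -> chi x = 0.
Proof.
elim=> [|y r z t Qr _ IHt].
  by rewrite -(scale0r 0) gcharZ mul0r.
by rewrite gcharD !(gcharM braid_charM) (chi_relations Qr) IHt mulr0 mul0r addr0.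
Qed.

Fact Qalg_nonzero : (1 : Q) != 0.
Proof.
apply/eqP; rewrite -qpi0 => /qpiP; rewrite subr0 => /chi_ideal /eqP.
by rewrite (gchar1 braid_char1) oner_eq0.
Qed.
HB.instance Definition _ := GRing.PzSemiRing_isNonZero.Build Q Qalg_nonzero.
HB.instance Definition _ := GRing.Lmodule_isLalgebra.Build R Q
  (@qscaleAl _ _ Q_relations).
HB.instance Definition _ := GRing.Lalgebra_isAlgebra.Build R Q
  (@qscaleAr _ _ Q_relations).

Definition Qbr (x : braid n) : Q := qpi Q_relations (gbas x).

Lemma QbrM x y : Qbr (x * y)%g = Qbr x * Qbr y.
Proof. by rewrite /Qbr gbasM qpiM. Qed.

Lemma Qbr1 : Qbr 1%g = 1.
Proof. by rewrite /Qbr gbas1. Qed.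

Lemma QbrVr x : Qbr x * Qbr x^-1%g = 1.
Proof. by rewrite -QbrM mulgV Qbr1. Qed.

Lemma QbrVl x : Qbr x^-1%g * Qbr x = 1.
Proof. by rewrite -QbrM mulVg Qbr1. Qed.

Lemma Qbr_relators :
  cubic_relator (Qbr (artin n 1)) = 0 /\
  Q_relator (Qbr (artin n 1)) (Qbr (artin n 2))
    (Qbr (artin n 1)^-1%g) (Qbr (artin n 2)^-1%g) = 0.
Proof.
pose f : RB -> Q := qpi Q_relations.
have fD : {morph f : x y / x + y} by exact: qpiD.
have fM : {morph f : x y / x * y} by exact: qpiM.
have fZ k x : f (k *: x) = k *: f x by exact: qpiZ.
have f0 r : Q_relations r -> f r = 0.
  move=> Qr; rewrite -[0](qpi0 Q_relations); apply/qpiP.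
  by rewrite subr0; exact: in_ideal_gen.
have [e1 e2] := relator_morph (gbas (artin n 1)) (gbas (artin n 2))
  (gbas (artin n 1)^-1%g) (gbas (artin n 2)^-1%g) fD fM fZ (erefl _).
by split; [rewrite -[LHS]e1 | rewrite -[LHS]e2]; apply: f0; [left | right].
Qed.

End QAlgebra.

Section Spans.
Variables (R : comNzRingType) (V : lmodType R) (A : algType R).

Inductive Rspan (S : set V) : V -> Prop :=
| Rspan0 : Rspan S 0
| RspanD k x y : S x -> Rspan S y -> Rspan S (k *: x + y).

Inductive subalg (S : set A) : A -> Prop :=
| subalg_gen x : S x -> subalg S x
| subalg1 : subalg S 1
| subalgD k x y : subalg S x -> subalg S y -> subalg S (k *: x + y)
| subalgM x y : subalg S x -> subalg S y -> subalg S (x * y).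

Definition sumset (B C : set V) : set V := [set x + y | x in B & y in C].

End Spans.

Notation "B :+: C" := (sumset B C)
  (at level 50, left associativity) : classical_set_scope.

(* laurent_var 0, laurent_var 1, laurent_var 2 are a, b, c.                   *)

Definition Qn n (n_ge3 : (2 < n)%N) :=
  Qalg (laurent_var 1) (laurent_var 2) (laurent_var_unit 0) n_ge3.
HB.instance Definition _ n (n_ge3 : (2 < n)%N) := GRing.Algebra.on (Qn n_ge3).

Definition Q4 := Qn (isT : 2 < 4)%N.
HB.instance Definition _ := GRing.Algebra.on Q4.

Definition Q4br (x : braid 4) : Q4 :=
  Qbr (laurent_var 1) (laurent_var 2) (laurent_var_unit 0)
    (isT : 2 < 4)%N x.

Definition Q3 : set Q4 := subalg [set Q4br (artin 4 1); Q4br (artin 4 2)].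

Definition Q3yQ3 (y : Q4) : set Q4 :=
  Rspan [set x * y * z | x in Q3 & z in Q3].

Definition Rline (y : Q4) : set Q4 := [set r *: y | r in [set: laurent]].

(* Main.v *)
(* Write B for the subalgebra generated by s1, s2 and t_i for the inverse of   *)
(* s_i. Modulo the B-bimodule M0 spanned by 1, s3, t3 and s3 t2 s3, the cubic  *)
(* relation alone gives s3 t2 t1 s3 t2 s3 = (abc)^3 t1 t2 t1 w0^-1.            *)
(* Conjugating the defining relation of Q_3 to the strands 2, 3, 4 and         *)
(* multiplying it by s3 on the left and t1 t2 s3 on the right shows that       *)
(* s3 t2 t1 s3 t2 s3 (s1 - a) is in M0; hence s1 acts as a on w0^-1 modulo M0. *)
(* The relations are stable under s_i <-> t_i, so the same holds for w0, and   *)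
(* M0 + R w0 + R w0^-1 = M0 + B w0 B + B w0^-1 B.                              *)
(* It remains to see that this bimodule is stable under s3. As                 *)
(* B = u1 + u1 s2 u1 + u1 t2 u1 + u1 d with u1 = <s1> and d = s2 s1^2 s2, which*)
(* commutes with u1, this is a finite check; its one difficult case,           *)
(* s3 t2 s1 s3 t2 s3, follows from the same relation multiplied by s3 and      *)
(* s1 t2 s3.                                                                   *)

Require Import Defs.
From HB Require Import structures.
From mathcomp Require Import all_boot all_order all_algebra.
From mathcomp Require Import boolp classical_sets.

Set Implicit Arguments.
Unset Strict Implicit.
Unset Printing Implicit Defensive.

Import GRing.Theory.

Local Open Scope classical_set_scope.
Local Open Scope ring_scope.

(** * Braid words *)

(* (i, true) is s_i and (i, false) its inverse; indices start at 1, whereas    *)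
(* the words of [braid_eq] use (i - 1, _).                                     *)
Local Notation letter := (nat * bool)%type.
Local Notation word := (seq letter).
Local Notation S1 := (1%N, true).
Local Notation T1 := (1%N, false).
Local Notation S2 := (2%N, true).
Local Notation T2 := (2%N, false).
Local Notation S3 := (3%N, true).
Local Notation T3 := (3%N, false).
Local Notation "'ε'" := (@nil letter).

(** Let B be the subalgebra generated by s1 and s2, t_i the inverse of s_i, and M0 the B-bimodule
    spanned by the words of [cores0]. Two facts give the theorem.

    M0 + B w0 B + B w0^-1 B contains every braid word ([word_span]). It contains 1 and is a
    B-bimodule, so stability under left multiplication by s3 suffices. As w0 commutes with B
    ([low2_comm]) and B has a small spanning set over u1 = <s1> ([low2_span]), which commutes with
    s3, only the finitely many products of [s3_core_in] and [s3_core_s3t2s3_in], besides s3 w0 and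
    s3 w0^-1, must be examined.

    Modulo M0, words in s1, s2 act on w0 and on w0^-1 by scalars ([eigen_span]), so B w0 B and B
    w0^-1 B shrink to lines. For w0^-1 this is [w0_inv_eigen]: the relation of Q_3 makes s1 act as a
    on the right of s3 t2 t1 s3 t2 s3, which modulo M0 is a unit times t1 t2 t1 w0^-1. The symmetry
    s_i <-> t_i, a <-> a^-1 ([cubic_gens_inv]) gives w0.

    Equalities of braids are settled by computation ([word_eqP]). *)

Definition letter_inv (x : letter) : letter := (x.1, ~~ x.2).

Definition inv_word (w : word) : word := rev (map letter_inv w).

(* The word x y x^-1 rewritten so that x only occurs in the middle; [None]    *)
(* unless y has index x.1 + 1 or commutes with x.                             *)
Definition conj_letter (x y : letter) : option word :=
  if (x.1, y.1) \in [:: (1, 2); (2, 3)]%N then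
    Some [:: (y.1, ~~ x.2); (x.1, y.2); (y.1, x.2)]
  else if (x.1, y.1) \in [:: (1, 3); (3, 1)]%N then Some [:: y] else None.

(** [p] is a prefix read backwards. Letters met before the inverse of [x] are conjugated by it and
    collected in [q]. *)
Fixpoint close_handle (x : letter) (p q : word) : option (word * word) :=
  if p is y :: p' then
    if y == letter_inv x then Some (p', q)
    else if conj_letter (letter_inv x) y is Some v then
      close_handle x p' (v ++ q)
    else None
  else None.

(* Dehornoy's handle reduction of [rev p ++ w], where [rev p] has no handle.   *)
Fixpoint reduce (fuel : nat) (p w : word) : word :=
  if fuel is n.+1 then
    if w is x :: w' then
      if close_handle x p [::] is Some (p', q) then reduce n p' (q ++ w')
      else reduce n (x :: p) w'
    else rev p
  else rev p ++ w.

(** A computable test for equality in B_4. Each step of [reduce] preserves the braid, so a positive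
    answer is a proof whatever the fuel. *)
Definition word_eq (u v : word) : bool :=
  reduce 1000 [::] (u ++ inv_word v) == [::].

(** Index 0 is excluded, so [low 0] holds of no letter and a two-sided span over [low 0] is a plain
    linear span. *)
Definition low (n : nat) : pred letter := fun x => (0 < x.1 <= n)%N.

Definition w0_word : word := [:: S3; S2; S1; S1; S2; S3].
Definition w0i_word : word := [:: T3; T2; T1; T1; T2; T3].
Definition cores0 : seq word := [:: [::]; [:: S3]; [:: T3]; [:: S3; T2; S3]].

Section BraidWords.
Variables (A : pzRingType) (g : letter -> A).

Definition ev (w : word) : A := \prod_(x <- w) g x.

Record braid_gens : Prop := BraidGens {
  gens_inv x : g x * g (letter_inv x) = 1;
  gens_near i : (i < 2)%N ->
    g (i.+1, true) * g (i.+2, true) * g (i.+1, true) =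
    g (i.+2, true) * g (i.+1, true) * g (i.+2, true);
  gens_far : g S1 * g S3 = g S3 * g S1 }.

Lemma ev_cat u v : ev (u ++ v) = ev u * ev v.
Proof. exact: big_cat. Qed.

Lemma ev_cons x u : ev (x :: u) = g x * ev u.
Proof. exact: big_cons. Qed.

Lemma ev_nil : ev [::] = 1.
Proof. exact: big_nil. Qed.

Lemma ev1 x : ev [:: x] = g x.
Proof. exact: big_seq1. Qed.

Hypothesis gP : braid_gens.

Lemma letter_invK : involutive letter_inv.
Proof. by case=> i e; rewrite /letter_inv negbK. Qed.

Lemma gens_invl x : g (letter_inv x) * g x = 1.
Proof. by rewrite -[in g x](letter_invK x) gens_inv. Qed.

Lemma ev_invl w : ev (inv_word w) * ev w = 1.
Proof.
elim: w => [|x w IHw]; first by rewrite ev_nil mulr1.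
rewrite /inv_word map_cons rev_cons -cats1 ev_cat ev1 ev_cons.
by rewrite -mulrA (mulrA (g _)) gens_invl mul1r.
Qed.

Lemma conj_near (x X y Y : A) : x * X = 1 -> Y * y = 1 ->
  x * y * x = y * x * y -> x * y * X = Y * x * y.
Proof.
move=> xX Yy xyx; rewrite -[LHS]mul1r -Yy -!mulrA; congr (Y * _).
by rewrite !mulrA -xyx -mulrA xX mulr1.
Qed.

Lemma inv_uniq (x y X Y : A) : X * x = 1 -> y * Y = 1 -> x = y -> X = Y.
Proof. by move=> Xx yY xy; rewrite -[X]mulr1 -yY mulrA -xy Xx mul1r. Qed.

Lemma conj_nearV (x X y Y : A) :
    x * X = 1 -> X * x = 1 -> y * Y = 1 -> Y * y = 1 ->
  x * y * x = y * x * y -> x * Y * X = Y * X * y.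
Proof.
move=> xX Xx yY Yy /(conj_near xX Yy) e; apply: inv_uniq e.
  by rewrite !mulrA -(mulrA _ X) Xx mulr1 -(mulrA x) Yy mulr1.
by rewrite !mulrA -(mulrA _ y) yY mulr1 -(mulrA Y) xX mulr1.
Qed.

Lemma conj_letterP x y v :
  conj_letter x y = Some v -> g x * g y * g (letter_inv x) = ev v.
Proof.
have near i e d : (i < 2)%N -> g (i.+1, e) * g (i.+2, d) * g (i.+1, ~~ e) =
    g (i.+2, ~~ e) * g (i.+1, d) * g (i.+2, e).
  move=> i2; have n := gens_near gP i2; have n' := esym n.
  have iT j : g (j, true) * g (j, false) = 1 := gens_inv gP (j, true).
  have iF j : g (j, false) * g (j, true) = 1 := gens_inv gP (j, false).
  case: e d => [] [] /=.
  - exact: conj_near.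
  - exact: conj_nearV.
  - by rewrite -(conj_near (iT _) (iF _) n').
  - by rewrite -(conj_nearV (iT _) (iF _) (iT _) (iF _) n').
have far i j e d : g (i, true) * g (j, true) = g (j, true) * g (i, true) ->
    g (i, e) * g (j, d) * g (i, ~~ e) = g (j, d).
  move=> c.
  have comm z t : GRing.comm (g z) (g t) ->
      GRing.comm (g z) (g (letter_inv t)).
    move=> zt; rewrite /GRing.comm -[LHS]mul1r -(gens_invl t) -!mulrA.
    by rewrite (mulrA (g t)) -zt -mulrA gens_inv // mulr1.
  have c2 : GRing.comm (g (i, e)) (g (j, true)).
    by case: e => //; apply/esym/(@comm (j, true) (i, true))/esym.
  have c3 : GRing.comm (g (i, e)) (g (j, d)).
    by case: d => //; apply: (@comm (i, e) (j, true)).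
  by rewrite c3 -mulrA (gens_inv gP (i, e)) mulr1.
rewrite /conj_letter; case: x y => [i e] [j d] /=; case: ifP.
  rewrite !inE => /orP[] /eqP[-> ->] [<-]; rewrite !ev_cons ev_nil mulr1 mulrA;
  exact: near.
move=> _; case: ifP => //; rewrite !inE => /orP[] /eqP[-> ->] [<-];
  rewrite ev1; apply: far.
  exact: gens_far.
exact/esym/gens_far.
Qed.

(** [m] is the product of the letters already crossed, and [q] spells its conjugate. *)
Lemma close_handleP x p q p' q' m : close_handle x p q = Some (p', q') ->
  g (letter_inv x) * m * g x = ev q ->
  ev (rev p) * m * g x = ev (rev p') * ev q'.
Proof.
elim: p q m => //= y p IHp q m; rewrite rev_cons -cats1 ev_cat ev1.
case: eqP => [-> [-> ->] <-|_]; first by rewrite !mulrA.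
case Ev: conj_letter => [v|] // /IHp{}IHp mq.
rewrite -(mulrA _ (g y)) IHp // ev_cat -mq -(conj_letterP Ev) letter_invK.
by rewrite !mulrA -(mulrA _ (g x)) gens_inv // mulr1.
Qed.

Lemma reduceP n p w : ev (reduce n p w) = ev (rev p ++ w).
Proof.
elim: n p w => //= n IHn p [|x w]; first by rewrite cats0.
case E: close_handle => [[p' q']|]; rewrite IHn.
  rewrite !ev_cat ev_cons !mulrA -(close_handleP (m := 1) E) ?mulr1 //.
  by rewrite gens_invl ev_nil.
by rewrite rev_cons -cats1 -catA.
Qed.

Lemma word_eqP u v : word_eq u v -> ev u = ev v.
Proof.
move/eqP => uv; have := reduceP 1000 [::] (u ++ inv_word v).
rewrite -/(_ ++ _) uv ev_nil /= ev_cat => e.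
by rewrite -[LHS]mulr1 -(ev_invl v) mulrA -e mul1r.
Qed.

End BraidWords.

Lemma braid_gens_inv (A : pzRingType) (g : letter -> A) :
  braid_gens g -> braid_gens (g \o letter_inv).
Proof.
move=> gP.
have inv3 x y z : ev g [:: x; y; z] = g x * g y * g z.
  by rewrite !ev_cons ev_nil mulr1 mulrA.
have inv2 x y : ev g [:: x; y] = g x * g y by rewrite !ev_cons ev_nil mulr1.
split=> [x|i|] /=; first exact: gens_inv.
  by case: i => [|[|]] // _; rewrite -!inv3; apply: (word_eqP gP).
by rewrite -!inv2; apply: (word_eqP gP).
Qed.

Lemma ev_inv (A : pzRingType) (g : letter -> A) w :
  ev (g \o letter_inv) w = ev g (map letter_inv w).
Proof. by rewrite /ev big_map. Qed.

(** * Linear spans *)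

Lemma submod_rpredN (R : pzRingType) (V : lmodType R) (K : submodClosed V) x :
  x \in K -> - x \in K.
Proof. by move=> Kx; rewrite -scaleN1r rpredZ. Qed.

Lemma submod_rpredB (R : pzRingType) (V : lmodType R) (K : submodClosed V) x y :
  x \in K -> y \in K -> x - y \in K.
Proof. by move=> Kx Ky; rewrite rpredD // submod_rpredN. Qed.

Section LinearSpans.
Variables (R : comNzRingType) (V : lmodType R).

Definition linear_set (S : set V) :=
  S 0 /\ forall k x y, S x -> S y -> S (k *: x + y).

Lemma sumset_linear (B C : set V) :
  linear_set B -> linear_set C -> linear_set (B :+: C).
Proof.
move=> [B0 BD] [C0 CD]; split; first by exists 0 => //; exists 0; rewrite ?addr0.
move=> k _ _ [x Bx [y Cy <-]] [z Bz [t Ct <-]].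
exists (k *: x + z); first exact: BD.
by exists (k *: y + t); [exact: CD | rewrite scalerDr addrACA].
Qed.

Lemma Rspan_linear (S : set V) : linear_set (Rspan S).
Proof.
split=> [|k x y Sx Sy]; first exact: Rspan0.
elim: Sx => [|l z t Sz _ IH]; first by rewrite scaler0 add0r.
by rewrite scalerDr scalerA -addrA; apply: RspanD.
Qed.

Lemma Rspan_gen (S : set V) x : S x -> Rspan S x.
Proof.
by move=> Sx; rewrite -[x]scale1r -[_ *: _]addr0; apply: RspanD; last exact: Rspan0.
Qed.

Lemma Rspan_min (S T : set V) : linear_set T -> S `<=` T -> Rspan S `<=` T.
Proof. by move=> [T0 TD] ST x; elim=> // k y z Sy _ Tz; apply/TD/Tz/ST. Qed.

End LinearSpans.

Lemma subalg_linear (R : comNzRingType) (A : algType R) (S : set A) :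
  linear_set (subalg S).
Proof.
split; last by move=> k x y; exact: subalgD.
by rewrite -(addNr (1 : A)) -scaleN1r; apply: subalgD; exact: subalg1.
Qed.

(** * Algebras with the cubic relation and the relation of Q_3 *)

Section CubicQuotient.
Variables (R : comUnitRingType) (A : algType R).
Variables (al be ga a : R) (g : letter -> A).

(* With al = a + b + c, be = - (ab + bc + ca) and ga = abc, the cubic         *)
(* relation multiplied by s^-2; this form is stable under s <-> s^-1.         *)
Record cubic_gens : Prop := CubicGens {
  cubic_braid : braid_gens g;
  cubic_ga : ga \is a GRing.unit;
  cubic_a : a \is a GRing.unit;
  cubic_s1 : g S1 = al%:A + be *: g T1 + ga *: (g T1 * g T1);
  cubic_rel : Q_relator a (g S1) (g S2) (g T1) (g T2) = 0 }.

Hypothesis gP : cubic_gens.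

Notation ev := (ev g).
Let gB := cubic_braid gP.
Let word_eqP := word_eqP gB.

Lemma ev_conj u v x y :
  word_eq (u ++ x :: v) [:: y] -> ev u * g x * ev v = g y.
Proof. by move=> /word_eqP; rewrite ev_cat ev_cons ev1 mulrA. Qed.

(** The Artin generators are conjugate, so all inherit the cubic relation of s1. *)
Lemma cubic_gen i : low 3 (i, true) ->
  g (i, true) = al%:A + be *: g (i, false) + ga *: (g (i, false) * g (i, false)).
Proof.
have tr p i1 : word_eq (p ++ S1 :: inv_word p) [:: (i1, true)] ->
    word_eq (p ++ T1 :: inv_word p) [:: (i1, false)] ->
    ev p * ev (inv_word p) = 1 ->
    g (i1, true) = al%:A + be *: g (i1, false) +
                   ga *: (g (i1, false) * g (i1, false)).
  move=> /ev_conj <- /ev_conj <- pp; rewrite (cubic_s1 gP) !mulrDr !mulrDl.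
  rewrite -!scalerAr -!scalerAl mulr1 pp; congr (_ + _ + _ *: _).
  have {}pp : ev (inv_word p) * ev p = 1 by apply: ev_invl.
  by rewrite -!mulrA; congr (_ * (_ * _)); rewrite !mulrA pp mul1r.
have c p : word_eq (p ++ inv_word p) [::] -> ev p * ev (inv_word p) = 1.
  by move/word_eqP; rewrite ev_cat ev_nil.
case: i => [|[|[|[|]]]] // _.
- exact: (cubic_s1 gP).
(* Conjugation by s1 s2 sends s1 to s2; conjugation by s2 s1 s3 s2 sends s1 to s3. *)
- by apply: (tr [:: S1; S2]) => //; apply: c.
- by apply: (tr [:: S2; S1; S3; S2]) => //; apply: c.
Qed.

Lemma cubic_ctx i u v : low 3 (i, true) ->
  ev (u ++ (i, true) :: v) = al *: ev (u ++ v) +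
    be *: ev (u ++ (i, false) :: v) + ga *: ev (u ++ [:: (i, false), (i, false) & v]).
Proof.
move=> i3; rewrite !ev_cat !ev_cons (cubic_gen i3) !mulrDl !mulrDr.
by rewrite -!scalerAl -!scalerAr mul1r -!mulrA.
Qed.

Lemma rel_ctx u v :
  ev (u ++ [:: T2, S3, S2 & v]) = ev (u ++ [:: S2, S3, T2 & v])
    - a^-1 *: ev (u ++ [:: S2, S3 & v]) + a *: ev (u ++ [:: S2, T3 & v])
    + a *: ev (u ++ [:: T2, S3 & v]) - a ^+ 3 *: ev (u ++ [:: T2, T3 & v])
    + a^-1 *: ev (u ++ [:: S3, S2 & v]) - a *: ev (u ++ [:: S3, T2 & v])
    - a *: ev (u ++ [:: T3, S2 & v]) + a ^+ 3 *: ev (u ++ [:: T3, T2 & v])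
    + a ^+ 2 *: ev (u ++ [:: T2, T3, S2 & v])
    - a ^+ 2 *: ev (u ++ [:: S2, T3, T2 & v]).
Proof.
(* Conjugation by s1 s2 s3 shifts s1, s2 to s2, s3, hence moves the relation of Q_3 to the strands
   2, 3, 4. *)
pose p := [:: S1; S2; S3]; pose f (x : A) := ev p * x * ev (inv_word p).
have pV : ev (inv_word p) * ev p = 1 by apply: ev_invl.
have fD : {morph f : x y / x + y} by move=> x y; rewrite /f mulrDr mulrDl.
have fM : {morph f : x y / x * y}.
  by move=> x y; rewrite /f !mulrA -(mulrA _ _ (ev p)) pV mulr1.
have fZ k x : f (k *: x) = k *: f x by rewrite /f -scalerAr -scalerAl.
have f1 : f 1 = 1.
  by rewrite /f mulr1 -ev_cat -(ev_nil g); apply: word_eqP.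
have f0 : f 0 = 0 by rewrite /f mulr0 mul0r.
have [_] := relator_morph a 0 0 (g S1) (g S2) (g T1) (g T2) fD fM fZ f1.
have fg x y : word_eq (p ++ x :: inv_word p) [:: y] -> f (g x) = g y.
  exact: ev_conj.
rewrite (cubic_rel gP) f0 (fg S1 S2) // (fg S2 S3) // (fg T1 T2) // (fg T2 T3) //.
move/esym/eqP; rewrite subr_eq0 => /eqP /(congr1 (fun x => ev u * x * ev v)).
rewrite /= !(mulrDl, mulrDr, mulNr, mulrN) -!scalerAr -!scalerAl.
by rewrite !ev_cat !ev_cons !mulrA.
Qed.

(** * Membership rules drawn from the relations *)

Section Submodule.
Variable K : submodClosed A.

(** The cubic relation links four consecutive powers of a generator, with units as outer
    coefficients. Hence an outer power lies in [K] once the other three do; [mem_ss], [mem_tt] and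
    [mem_t] are the other instances. *)
Lemma mem_s i u v : low 3 (i, true) -> ev (u ++ v) \in K ->
    ev (u ++ (i, false) :: v) \in K ->
    ev (u ++ [:: (i, false), (i, false) & v]) \in K ->
  ev (u ++ (i, true) :: v) \in K.
Proof. by move=> i3 *; rewrite cubic_ctx //; do ?apply: rpredD; apply: rpredZ. Qed.

Lemma ev_cancel x u v : ev (u ++ [:: x, letter_inv x & v]) = ev (u ++ v).
Proof. by rewrite !ev_cat !ev_cons (mulrA (g x)) gens_inv // mul1r. Qed.

Lemma mem_ss i u v : low 3 (i, true) -> ev (u ++ (i, true) :: v) \in K ->
    ev (u ++ v) \in K -> ev (u ++ (i, false) :: v) \in K ->
  ev (u ++ [:: (i, true), (i, true) & v]) \in K.
Proof.
move=> i3 *; apply: mem_s => //; first by rewrite (ev_cancel (i, false)).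
by rewrite -cat_rcons (ev_cancel (i, false)) cat_rcons.
Qed.

Lemma mem_tt i u v : low 3 (i, true) -> ev (u ++ (i, true) :: v) \in K ->
    ev (u ++ v) \in K -> ev (u ++ (i, false) :: v) \in K ->
  ev (u ++ [:: (i, false), (i, false) & v]) \in K.
Proof.
move=> i3 Ks K1 Kt; rewrite -[ev _]scale1r -(mulVr (cubic_ga gP)) -scalerA rpredZ //.
have := cubic_ctx u v i3; rewrite addrC => /eqP; rewrite -subr_eq => /eqP e.
by rewrite -e; apply: submod_rpredB => //; apply: rpredD; apply: rpredZ.
Qed.

Lemma mem_t i u v : low 3 (i, true) ->
    ev (u ++ [:: (i, true), (i, true) & v]) \in K ->
    ev (u ++ (i, true) :: v) \in K -> ev (u ++ v) \in K ->
  ev (u ++ (i, false) :: v) \in K.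
Proof.
move=> i3 Kss Ks K1; have := @mem_tt i u ((i, true) :: v) i3 Kss Ks.
rewrite (ev_cancel (i, false)) => /(_ K1).
by rewrite -cat_rcons (ev_cancel (i, false)) cat_rcons.
Qed.

End Submodule.

(** Of the twelve terms of the relation, ten are assumed in [K]; the two left over, t2 s3 s2 and a
    t2 s3, produce the eigenvalue a. *)
Lemma mem_rel (K : submodClosed A) u v :
    ev (u ++ [:: S2, S3, T2 & v]) \in K -> ev (u ++ [:: S2, S3 & v]) \in K ->
    ev (u ++ [:: S2, T3 & v]) \in K -> ev (u ++ [:: T2, T3 & v]) \in K ->
    ev (u ++ [:: S3, S2 & v]) \in K -> ev (u ++ [:: S3, T2 & v]) \in K ->
    ev (u ++ [:: T3, S2 & v]) \in K -> ev (u ++ [:: T3, T2 & v]) \in K ->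
    ev (u ++ [:: T2, T3, S2 & v]) \in K -> ev (u ++ [:: S2, T3, T2 & v]) \in K ->
  ev (u ++ [:: T2, S3, S2 & v]) - a *: ev (u ++ [:: T2, S3 & v]) \in K.
Proof.
move=> *; rewrite rel_ctx; set e := a *: ev (u ++ [:: T2, S3 & v]).
rewrite -!addrA 3!(addrCA _ e) addrC !addrA subrK.
by do ?[apply: rpredD | apply: submod_rpredN | apply: rpredZ].
Qed.

Section Bimodule.
Variables (K : submodClosed A) (n : nat).
Hypothesis K_l : forall x y, low n x -> y \in K -> g x * y \in K.
Hypothesis K_r : forall x y, low n x -> y \in K -> y * g x \in K.

Lemma mem_lr u w v :
  all (low n) u -> all (low n) v -> ev w \in K -> ev (u ++ w ++ v) \in K.
Proof.
move=> ul vl Kw; rewrite !ev_cat; have {Kw} : ev w * ev v \in K.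
  elim/last_ind: v vl => [|v x IHv]; first by rewrite ev_nil mulr1.
  rewrite all_rcons -cats1 ev_cat ev1 mulrA => /andP[xl vl].
  by apply: K_r => //; apply: IHv.
elim: u ul => [|x u IHu] /=; first by rewrite ev_nil mul1r.
by move=> /andP[xl ul] Kw; rewrite ev_cons -mulrA; apply/K_l/IHu.
Qed.

Lemma mem_r w v : all (low n) v -> ev w \in K -> ev (w ++ v) \in K.
Proof. exact: (@mem_lr [::]). Qed.

Lemma mem_ctx u w v w' :
    [&& all (low n) u, all (low n) v & word_eq w' (u ++ w ++ v)] ->
  ev w \in K -> ev w' \in K.
Proof. by move=> /and3P[ul vl /word_eqP ->]; apply: mem_lr. Qed.

Lemma submod_unitZ k x : k \is a GRing.unit -> k *: x \in K -> x \in K.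
Proof. by move=> uk Kx; rewrite -[x]scale1r -(mulVr uk) -scalerA rpredZ. Qed.

End Bimodule.

Lemma cubic_mod (K : submodClosed A) i u v : low 3 (i, true) ->
    ev (u ++ v) \in K -> ev (u ++ (i, false) :: v) \in K ->
  ev (u ++ (i, true) :: v) - ga *: ev (u ++ [:: (i, false), (i, false) & v]) \in K.
Proof. by move=> i3 *; rewrite cubic_ctx // addrK rpredD // rpredZ. Qed.

(** * The action of s1 on w0^-1 *)

Section Eigenvector.
Variable K : submodClosed A.
Hypothesis K_l : forall x y, low 2 x -> y \in K -> g x * y \in K.
Hypothesis K_r : forall x y, low 2 x -> y \in K -> y * g x \in K.
Hypotheses (K1 : ev [::] \in K) (Ks3 : ev [:: S3] \in K) (Kt3 : ev [:: T3] \in K).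
Hypothesis Ksts : ev [:: S3; T2; S3] \in K.

Local Ltac ctx u w v := apply: (mem_ctx K_l K_r (u := u) (w := w) (v := v)) => //.

(** The mirror image of the core s3 t2 s3, so the hypotheses on [K] are symmetric under s_i <->
    t_i. *)
Lemma t3s2t3_in : ev [:: T3; S2; T3] \in K.
Proof.
suff : ga *: ev [:: S3; T2; T3; T3] \in K.
  by move/(submod_unitZ (cubic_ga gP)); ctx [:: S2] [:: S3; T2; T3; T3] ε.
have := @cubic_ctx 3 [:: S3; T2] [::] isT.
rewrite addrC => /eqP; rewrite -subr_eq => /eqP <-.
apply: submod_rpredB => //; apply: rpredD; apply: rpredZ.
  by ctx ε [:: S3] [:: T2].
by ctx [:: T2] [:: T3] [:: S2].
Qed.

Lemma s3s3t2s3_in : ev [:: S3; S3; T2; S3] \in K.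
Proof.
apply: (@mem_ss K 3 [::]) => //; first by ctx [:: T2] [:: S3] ε.
by ctx [:: S2] [:: T3] [:: T2].
Qed.

Lemma t3t3_in : ev [:: T3; T3] \in K.
Proof. exact: (@mem_tt K 3 [::] [::]). Qed.

Lemma t3t2t2t3_in : ev [:: T3; T2; T2; T3] \in K.
Proof.
apply: (@mem_tt K 2 [:: T3]) => //; [exact: t3s2t3_in | exact: t3t3_in |].
by ctx [:: T2] [:: T3] [:: T2].
Qed.

(** Three times a positive letter is traded for [ga] times its inverse square, first s3, then s2,
    then s1; each time the lower terms of the cubic relation fall into [K]. *)
Lemma s3t2t1s3t2s3_mod :
  ev [:: S3; T2; T1; S3; T2; S3]
    - ga ^+ 3 *: ev [:: T1; T2; T1; T3; T2; T1; T1; T2; T3] \in K.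
Proof.
have D1 : ev [:: S3; T2; T1; S3; T2; S3]
    - ga *: ev [:: T1; T2; T3; S2; T1; S2; T3] \in K.
  have -> : ev [:: T1; T2; T3; S2; T1; S2; T3]
      = ev [:: S3; T2; T1; S3; T2; T3; T3] by apply: word_eqP.
  apply: (@cubic_mod K 3 [:: S3; T2; T1; S3; T2] [::]) => //.
    by ctx ε [:: S3; T2; S3] [:: T1; T2].
  by ctx [:: T1; T2] [:: T3] [:: S2; T1; S2].
have D2 : ev [:: T1; T2; T3; S2; T1; S2; T3]
    - ga *: ev [:: T1; T2; T1; T3; T2; S1; T2; T3] \in K.
  have -> : ev [:: T1; T2; T1; T3; T2; S1; T2; T3]
      = ev [:: T1; T2; T3; S2; T1; T2; T2; T3] by apply: word_eqP.
  apply: (@cubic_mod K 2 [:: T1; T2; T3; S2; T1] [:: T3]) => //.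
    by ctx [:: T1; T2] [:: T3; S2; T3] [:: T1]; apply: t3s2t3_in.
  by ctx [:: T1; T2; T1; T2] [:: T3] [:: T2; S1].
have D3 : ev [:: T1; T2; T1; T3; T2; S1; T2; T3]
    - ga *: ev [:: T1; T2; T1; T3; T2; T1; T1; T2; T3] \in K.
  apply: (@cubic_mod K 1 [:: T1; T2; T1; T3; T2] [:: T2; T3]) => //.
    by ctx [:: T1; T2; T1] [:: T3; T2; T2; T3] ε; apply: t3t2t2t3_in.
  by ctx [:: T1; T2; T1; T1; T2] [:: T3] [:: T2; T1].
have := rpredD (rpredD D1 (rpredZ ga D2)) (rpredZ (ga ^+ 2) D3).
by rewrite !scalerBr !scalerA -expr2 -exprSr !addrA !subrK.
Qed.

(** As braids, the two words are s3 (t2 s3 s2) t1 t2 s3 and s3 (t2 s3) t1 t2 s3, the two terms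
    singled out by [mem_rel]. *)
Lemma s3t2t1s3t2s3_eigen :
  ev [:: S3; T2; T1; S3; T2; S3; S1] - a *: ev [:: S3; T2; T1; S3; T2; S3] \in K.
Proof.
have -> : ev [:: S3; T2; T1; S3; T2; S3; S1]
    = ev [:: S3; T2; S3; S2; T1; T2; S3] by apply: word_eqP.
have -> : ev [:: S3; T2; T1; S3; T2; S3]
    = ev [:: S3; T2; S3; T1; T2; S3] by apply: word_eqP.
apply: (@mem_rel K [:: S3] [:: T1; T2; S3]).
- by ctx [:: S2; T1] [:: S3; T2; S3] ε.
- by ctx [:: S2; T1] [:: S3; T2; S3] [:: S1].
- by ctx [:: T2; T1] [:: S3; T2; S3] [:: S1].
- by ctx [:: T2; T1; S2] [:: T3] [:: T2; S1].
- by ctx [:: T1] [:: S3; S3; T2; S3] [:: S1]; apply: s3s3t2s3_in.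
- by ctx [:: T1] [:: S3; S3; T2; S3] [:: T1]; apply: s3s3t2s3_in.
- by ctx [:: S2; T1; T2] [:: S3] ε.
- by ctx [:: T2; T1; T2] [:: S3] ε.
- by ctx [:: T2; T1; S2] [:: T3] [:: T2; S1; S1].
- by ctx [:: T2; T1] [:: S3; T2; S3] ε.
Qed.

Lemma w0_inv_eigen :
  ev (S1 :: w0i_word) - a *: ev w0i_word \in K.
Proof.
set z := _ - _.
(* Both t1 t2 t1 and [ga] are invertible, and multiplying by them brings in the element of
   [s3t2t1s3t2s3_mod]. *)
suff Kz : ga ^+ 3 *: (ev [:: T1; T2; T1] * z) \in K.
  have -> : z = ev [:: S1; S2; S1] * (ev [:: T1; T2; T1] * z).
    rewrite mulrA -ev_cat (_ : ev _ = 1) ?mul1r // -(ev_nil g).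
    exact: word_eqP.
  have {}Kz := submod_unitZ (unitrX 3 (cubic_ga gP)) Kz.
  move: (_ * z) Kz => y Ky; rewrite !ev_cons ev_nil mulr1 -!mulrA.
  by do 3 (apply: K_l => //).
set x := ev [:: S3; T2; T1; S3; T2; S3].
have Kx := s3t2t1s3t2s3_mod; have Ke := s3t2t1s3t2s3_eigen.
rewrite -/x in Kx Ke; move: Kx; set y := ga ^+ 3 *: _ => Kx.
(* w0^-1 commutes with s1, so s1 can be moved to the right end. *)
have -> : ga ^+ 3 *: (ev [:: T1; T2; T1] * z) = y * g S1 - a *: y.
  rewrite /y -scalerAl (scalerA a) (mulrC a) -(scalerA _ a) -scalerBr -ev1 -ev_cat.
  congr (_ *: _).
  rewrite /z mulrBr -scalerAr -!ev_cat; congr (_ - _).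
  exact: word_eqP.
(* [x - y] is in [K], which is stable under s1 on the right, so the eigenvalue passes from [x] to
   [y]. *)
have -> : y * g S1 - a *: y =
    x * g S1 - a *: x - ((x - y) * g S1 - a *: (x - y)).
  rewrite mulrBl scalerBr !opprB -(addrA (a *: x)) subrKA [RHS]addrC -!addrA.
  by rewrite addNr addr0 addrC.
apply: submod_rpredB; first by rewrite -(ev1 g S1) -ev_cat.
by apply: submod_rpredB; [apply: K_r | apply: rpredZ].
Qed.

(** * Stability under s3 *)

Section Stability.
Hypothesis Kw0 : ev w0_word \in K.
Hypothesis Kw0i : ev w0i_word \in K.

Lemma s3s3_in : ev [:: S3; S3] \in K.
Proof. exact: (@mem_ss K 3 [::] [::]). Qed.

Lemma s3s2s3_in : ev [:: S3; S2; S3] \in K.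
Proof. by ctx [:: S2] [:: S3] [:: S2]. Qed.

Lemma s3s2s2s3_in : ev [:: S3; S2; S2; S3] \in K.
Proof.
by apply: (@mem_ss K 2 [:: S3]) => //; [apply: s3s2s3_in | apply: s3s3_in].
Qed.

Lemma s3dt3_in : ev [:: S3; S2; S1; S1; S2; T3] \in K.
Proof. by ctx [:: T2; T1] [:: S3; S2; S2; S3] [:: S1; S2]; apply: s3s2s2s3_in. Qed.

Lemma t3ds3_in : ev [:: T3; S2; S1; S1; S2; S3] \in K.
Proof. by ctx [:: S2; S1] [:: S3; S2; S2; S3] [:: T1; T2]; apply: s3s2s2s3_in. Qed.

Lemma s3w0_in : ev [:: S3; S3; S2; S1; S1; S2; S3] \in K.
Proof.
apply: (@mem_ss K 3 [::]) => //; last exact: t3ds3_in.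
by ctx [:: S2; S1; S1; S2] [:: S3] ε.
Qed.

Lemma w0s3_in : ev [:: S3; S2; S1; S1; S2; S3; S3] \in K.
Proof.
apply: (@mem_ss K 3 [:: S3; S2; S1; S1; S2] [::]) => //; last exact: s3dt3_in.
by ctx ε [:: S3] [:: S2; S1; S1; S2].
Qed.

Lemma s3w0i_in : ev [:: S3; T3; T2; T1; T1; T2; T3] \in K.
Proof. by ctx [:: T2; T1; T1; T2] [:: T3] ε. Qed.

Lemma s3t2s1t2s3_in : ev [:: S3; T2; S1; T2; S3] \in K.
Proof.
apply: (@mem_t K 2 [:: S3]) => //.
(* Here s2 s1 t2 = t1 s2 s1; removing t1 by the cubic relation then produces w0. *)
- ctx ε [:: S3; S2; T1; S2; S3] [:: S1].
  apply: (@mem_t K 1 [:: S3; S2]) => //; last exact: s3s2s2s3_in.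
  by ctx [:: S1; S2] [:: S3] [:: S2; S1].
- by ctx [:: T1; S2] [:: S3] [:: S2; S1].
- by ctx [:: S1] [:: S3; T2; S3] ε.
Qed.

Lemma s3t2s3t2s3_in : ev [:: S3; T2; S3; T2; S3] \in K.
Proof.
apply: (@mem_s K 3 [:: S3; T2; S3; T2] [::]) => //.
- by ctx ε [:: S3; T2; S3] [:: T2].
- by ctx [:: T2] [:: T3; T3] [:: S2; S2]; apply: t3t3_in.
ctx [:: T2] [:: T3; T3; S2; S2; T3] ε.
apply: (@mem_tt K 3 [::]) => //.
- by ctx [:: T2] [:: S3; S3] [:: S2]; apply: s3s3_in.
- by ctx [:: S2; S2] [:: T3] ε.
apply: (@mem_ss K 2 [:: T3]) => //; [exact: t3s2t3_in | exact: t3t3_in |].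
by ctx [:: T2] [:: T3] [:: T2].
Qed.

Lemma s3t2t1s3t2s3_in : ev [:: S3; T2; T1; S3; T2; S3] \in K.
Proof.
have Kt : ev [:: T1; T2; T1; T3; T2; T1; T1; T2; T3] \in K.
  by ctx [:: T1; T2; T1] [:: T3; T2; T1; T1; T2; T3] ε.
by have := rpredD s3t2t1s3t2s3_mod (rpredZ (ga ^+ 3) Kt); rewrite subrK.
Qed.

(** [mem_rel] in the context s3, s1 t2 s3 compares a times this word with s3 (t2 s3 s2) s1 t2 s3,
    which a braid identity already puts in [K]; then a is cancelled. *)
Lemma s3t2s1s3t2s3_in : ev [:: S3; T2; S1; S3; T2; S3] \in K.
Proof.
ctx ε [:: S3; T2; S3; S1; T2; S3] ε.
apply: (submod_unitZ (cubic_a gP)).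
have Kl : ev [:: S3; T2; S3; S2; S1; T2; S3] \in K.
  by ctx [:: S1] [:: S3; T2; S3] [:: T1; S2; S1].
suff Kr : ev [:: S3; T2; S3; S2; S1; T2; S3]
    - a *: ev [:: S3; T2; S3; S1; T2; S3] \in K.
  by have := submod_rpredB Kl Kr; rewrite opprB addrCA subrr addr0.
apply: (@mem_rel K [:: S3] [:: S1; T2; S3]).
- by ctx [:: S2; S1] [:: S3; T2; S3] ε.
- by ctx [:: S2; T1; S2] [:: S3] [:: S2; S1].
- by ctx [:: T2; T1; S2] [:: S3] [:: S2; S1].
- by ctx [:: T2; T1; S2] [:: S3] [:: T2; S1].
- by ctx [:: T1; S2] [:: S3] [:: S2; S2; S1].
- apply: (@mem_ss K 3 [::]) => //; first exact: s3t2s1t2s3_in.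
    by ctx [:: T2; S1; T2] [:: S3] ε.
  by ctx [:: S2; S1] [:: T3; S2; T3] [:: T1; T2]; apply: t3s2t3_in.
- by ctx [:: S2; S1; T2] [:: S3] ε.
- by ctx [:: T2; S1; T2] [:: S3] ε.
- by ctx [:: T2; S2; S1] [:: S3; T2; S3] [:: T1; T2; S1].
- by ctx [:: T2; S1] [:: S3; T2; S3] ε.
Qed.

Lemma s3_core_in w m :
    w \in [:: [::]; [:: S2]; [:: T2]; [:: S2; S1; S1; S2]] ->
    m \in [:: [::]; [:: S3]; [:: T3]] ->
  ev (S3 :: w ++ m) \in K.
Proof.
rewrite !inE => /or4P[] /eqP -> /or3P[] /eqP -> //.
- exact: s3s3_in.
- by ctx ε ε ε.
- by ctx ε [:: S3] [:: S2].
- exact: s3s2s3_in.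
- by ctx [:: T2] [:: S3] [:: S2].
- by ctx ε [:: S3] [:: T2].
- by ctx [:: T2] [:: T3] [:: S2].
- by ctx ε [:: S3] [:: S2; S1; S1; S2].
- exact: s3dt3_in.
Qed.

Lemma s3_core_s3t2s3_in w r :
    w \in [:: [::]; [:: S2]; [:: T2]; [:: S2; S1; S1; S2]] ->
    r \in [:: [::]; [:: S1]; [:: T1]] ->
  ev (S3 :: w ++ r ++ [:: S3; T2; S3]) \in K.
Proof.
rewrite !inE => /or4P[] /eqP -> /or3P[] /eqP -> //.
- exact: s3s3t2s3_in.
- by ctx [:: S1] [:: S3; S3; T2; S3] ε; apply: s3s3t2s3_in.
- by ctx [:: T1] [:: S3; S3; T2; S3] ε; apply: s3s3t2s3_in.
- by ctx [:: S2] [:: S3; S3] ε; apply: s3s3_in.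
- by ctx [:: S2; T1; S2] [:: S3] [:: S2; S1].
- by ctx [:: S2; T1] [:: S3; T2; S3] [:: S1].
- exact: s3t2s3t2s3_in.
- exact: s3t2s1s3t2s3_in.
- exact: s3t2t1s3t2s3_in.
- by ctx [:: T2] [:: S3; S2; S1; S1; S2; S3; S3] ε; apply: w0s3_in.
- by ctx [:: S1; T2] [:: S3; S2; S1; S1; S2; S3; S3] ε; apply: w0s3_in.
- by ctx [:: T1; T2] [:: S3; S2; S1; S1; S2; S3; S3] ε; apply: w0s3_in.
Qed.

End Stability.
End Eigenvector.

(** * Spanning sets of words *)

Section WordSpan.
Variables (n : nat) (cores : seq word).

Definition wspan : {pred A} := fun x => `[< Rspan
  [set y | exists u w v, [/\ all (low n) u, w \in cores, all (low n) v
                           & y = ev (u ++ w ++ v)]] x >].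

Fact wspan_submod : submod_closed wspan.
Proof.
have [S0 SD] := @Rspan_linear R A [set y | exists u w v,
  [/\ all (low n) u, w \in cores, all (low n) v & y = ev (u ++ w ++ v)]].
by split=> [|k x y /asboolP Sx /asboolP Sy]; apply/asboolP => //; apply: SD.
Qed.
HB.instance Definition _ := GRing.isSubmodClosed.Build R A wspan wspan_submod.

Lemma wspan_gen u w v : all (low n) u -> w \in cores -> all (low n) v ->
  ev (u ++ w ++ v) \in wspan.
Proof.
by move=> un wc vn; apply/asboolP/Rspan_gen; exists u, w, v.
Qed.

Lemma wspan_ind (K : submodClosed A) p q :
    (forall u w v, all (low n) u -> w \in cores -> all (low n) v ->
       ev (p ++ u ++ w ++ v ++ q) \in K) ->
  forall x, x \in wspan -> ev p * x * ev q \in K.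
Proof.
move=> Kw x /asboolP; elim=> [|k y z [u [w [v [un wc vn ->]]]] _ IH].
  by rewrite mulr0 mul0r rpred0.
rewrite mulrDr mulrDl rpredD // -scalerAr -scalerAl rpredZ //.
by rewrite -!ev_cat -!catA; apply: Kw.
Qed.

Lemma wspan_l x y : low n x -> y \in wspan -> g x * y \in wspan.
Proof.
move=> xn; rewrite -[g x * y]mulr1 -(ev_nil g) -[in g x](ev1 g x).
apply: wspan_ind => u w v un wc vn.
by rewrite cats0; apply: (@wspan_gen (x :: u)); rewrite //= xn.
Qed.

Lemma wspan_r x y : low n x -> y \in wspan -> y * g x \in wspan.
Proof.
move=> xn; rewrite -[y * _]mul1r -(ev_nil g) mulrA -[in g x](ev1 g x).
apply: wspan_ind => u w v un wc vn.
by apply: (@wspan_gen u); rewrite // all_cat vn /= xn.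
Qed.

End WordSpan.

Lemma low0_nil u : all (low 0) u -> u = [::].
Proof. by case: u => [//|[[|i] e] u]. Qed.

Lemma gen_inv i : low 3 (i, true) -> g (i, false) =
  ga^-1 *: (g (i, true) * g (i, true) - al *: g (i, true) - be%:A).
Proof.
move=> i3; have := @cubic_ctx i [::] [:: (i, true)] i3.
rewrite (ev_cancel (i, false) [::]) (ev_cancel (i, false) [:: (i, false)]).
rewrite !ev_cons !ev_nil !mulr1 => ->.
rewrite (addrC _ (ga *: _)) -addrA -opprD addrK scalerA mulVr ?scale1r //.
exact: (cubic_ga gP).
Qed.

(** Each t_i is a polynomial in s_i, so left stability need only be checked for positive letters. *)
Lemma submod_inv (K : submodClosed A) i : low 3 (i, true) ->
    (forall y, y \in K -> g (i, true) * y \in K) ->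
  forall y, y \in K -> g (i, false) * y \in K.
Proof.
move=> i3 Ks y Ky; rewrite gen_inv // -scalerAl rpredZ // !mulrBl.
by rewrite -!mulrA -!scalerAl mul1r !submod_rpredB ?rpredZ ?Ks.
Qed.

Lemma low1_span u : all (low 1) u -> ev u \in wspan 0 [:: [::]; [:: S1]; [:: T1]].
Proof.
pose N : submodClosed A := wspan 0 [:: [::]; [:: S1]; [:: T1]].
rewrite -[wspan _ _]/(N : {pred A}).
have N1 : ev [::] \in N by apply: (@wspan_gen 0 _ [::] [::] [::]).
have Ns : ev [:: S1] \in N by apply: (@wspan_gen 0 _ [::] [:: S1] [::]).
have Nt : ev [:: T1] \in N by apply: (@wspan_gen 0 _ [::] [:: T1] [::]).
have Nc x w : low 1 x -> w \in [:: [::]; [:: S1]; [:: T1]] -> ev (x :: w) \in N.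
  case: x => [[|[|i]] []] // _ wc; rewrite !inE in wc;
    case/or3P: wc => /eqP -> //.
  - exact: (@mem_ss N 1 [::] [::]).
  - by rewrite (ev_cancel S1 [::]).
  - by rewrite (ev_cancel T1 [::]).
  - exact: (@mem_tt N 1 [::] [::]).
elim: u => [//|x u IHu] /= /andP[xl ul].
rewrite ev_cons -[_ * _]mulr1 -(ev_nil g) -[in g x](ev1 g x).
apply: wspan_ind (IHu ul) => v w v' /low0_nil-> wc /low0_nil->.
by rewrite !cats0; apply: Nc.
Qed.

(** The span is a u1-bimodule containing 1, so only s2 on the left needs checking; [Nc] treats the
    twelve products left once the u1 factor is reduced to 1, s1 or t1. *)
Lemma low2_span u : all (low 2) u ->
  ev u \in wspan 1 [:: [::]; [:: S2]; [:: T2]; [:: S2; S1; S1; S2]].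
Proof.
set cs := [:: _; _; _; _]; pose N : submodClosed A := wspan 1 cs.
rewrite -[wspan _ _]/(N : {pred A}).
have N_l : forall x y, low 1 x -> y \in N -> g x * y \in N by exact: wspan_l.
have N_r : forall x y, low 1 x -> y \in N -> y * g x \in N by exact: wspan_r.
have N_gen w : w \in cs -> ev w \in N.
  by move=> wc; rewrite -[w]cats0; apply: (@wspan_gen 1 _ [::] w [::]).
have N1 : ev [::] \in N by apply: N_gen.
have Ns : ev [:: S2] \in N by apply: N_gen.
have Nt : ev [:: T2] \in N by apply: N_gen.
have Nd : ev [:: S2; S1; S1; S2] \in N by apply: N_gen.
have N22 : ev [:: S2; S2] \in N by apply: (@mem_ss N 2 [::] [::]).
have Nsd : ev [:: S2; S2; S1; S1; S2] \in N.
  apply: (@mem_ss N 2 [::]) => //.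
    by apply: (mem_ctx N_l N_r (u := [:: S1; S1]) (w := [:: S2]) (v := [::])).
  by apply: (mem_ctx N_l N_r (u := [:: S1]) (w := [:: S2; S2]) (v := [:: T1])).
have Ns1s : ev [:: S2; S1; S2] \in N.
  by apply: (mem_ctx N_l N_r (u := [:: S1]) (w := [:: S2]) (v := [:: S1])).
have Ns1d : ev [:: S2; S1; S2; S1; S1; S2] \in N.
  apply: (mem_ctx N_l N_r (u := [:: S1]) (w := [:: S2; S1; S1; S1; S2])
            (v := [::])) => //.
  apply: (@mem_ss N 1 [:: S2]) => //.
  by apply: (mem_ctx N_l N_r (u := [::]) (w := [:: S2; S2]) (v := [::])).
have Nc r w : r \in [:: [::]; [:: S1]; [:: T1]] -> w \in cs -> ev (S2 :: r ++ w) \in N.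
  move=> rc wc; rewrite !inE in rc wc.
  case/or3P: rc => /eqP ->; case/or4P: wc => /eqP -> //=.
  - by rewrite (ev_cancel S2 [::]).
  - by apply: (mem_ctx N_l N_r (u := [::]) (w := [:: S2]) (v := [:: S1])).
  - by apply: (mem_ctx N_l N_r (u := [:: T1]) (w := [:: S2]) (v := [:: S1])).
  - by apply: (mem_ctx N_l N_r (u := [::]) (w := [:: S2]) (v := [:: T1])).
  - by apply: (@mem_t N 1 [:: S2]).
  - by apply: (mem_ctx N_l N_r (u := [:: T1]) (w := [:: T2]) (v := [:: S1])).
  - apply: (@mem_t N 1 [:: S2]) => //.
    apply: (mem_ctx N_l N_r (u := [:: S1; S1]) (w := [:: S2; S1; S1; S2; S2])
              (v := [::])) => //.
    apply: (@mem_ss N 2 [:: S2; S1; S1] [::]) => //.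
      by apply: (mem_ctx N_l N_r (u := [::]) (w := [:: S2]) (v := [:: S1; S1])).
    by apply: (mem_ctx N_l N_r (u := [:: T1]) (w := [:: S2; S2]) (v := [:: S1])).
have N_s y : y \in N -> g S2 * y \in N.
  rewrite -[_ * y]mulr1 -(ev_nil g) -(ev1 g S2).
  apply: wspan_ind => u1 w v ul wc vl; rewrite cats0 !catA.
  apply: (mem_r N_l N_r) => //.
  rewrite -catA !ev_cat mulrA; apply: wspan_ind (low1_span ul).
  by move=> v1 r v2 /low0_nil-> rc /low0_nil->; apply: (Nc r w).
have {}N_l x y : low 2 x -> y \in N -> g x * y \in N.
  case: x => [[|[|[|i]]] e] // _; first exact: N_l.
  by case: e; [apply: N_s | apply: (@submod_inv N 2)].
elim: u => [//|x u IHu] /= /andP[xl ul].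
by rewrite ev_cons; apply/N_l/IHu.
Qed.

Lemma comm_word w u : all (fun x => word_eq (rcons w x) (x :: w)) u ->
  ev (u ++ w) = ev (w ++ u).
Proof.
elim: u => [|x u IHu] /=; first by rewrite cats0.
move=> /andP[/word_eqP xw /IHu e].
by rewrite ev_cons e -cat_rcons !ev_cat xw ev_cons mulrA.
Qed.

Lemma low1_comm u : all (low 1) u ->
  ev (u ++ [:: S3]) = ev (S3 :: u) /\ ev (u ++ [:: T3]) = ev (T3 :: u).
Proof.
by move=> ul; split; apply: comm_word; apply: sub_all ul => -[[|[|]] []].
Qed.

(** w0 is the pure braid carrying the last strand around the other three, the quotient of the full
    twists of B_4 and B_3, hence commutes with B_3. *)
Lemma low2_comm u : all (low 2) u ->
  ev (u ++ w0_word) = ev (w0_word ++ u) /\ ev (u ++ w0i_word) = ev (w0i_word ++ u).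
Proof.
by move=> ul; split; apply: comm_word; apply: sub_all ul => -[[|[|[|]]] []].
Qed.

Lemma word_span u : all (low 3) u ->
  ev u \in wspan 2 (cores0 ++ [:: w0_word; w0i_word]).
Proof.
set cs := cores0 ++ _; pose N : submodClosed A := wspan 2 cs.
rewrite -[wspan _ _]/(N : {pred A}).
have N_l : forall x y, low 2 x -> y \in N -> g x * y \in N by exact: wspan_l.
have N_r : forall x y, low 2 x -> y \in N -> y * g x \in N by exact: wspan_r.
have N_gen w : w \in cs -> ev w \in N.
  by move=> wc; rewrite -[w]cats0; apply: (@wspan_gen 2 _ [::] w [::]).
have N1 : ev [::] \in N by apply: N_gen.
have Ns : ev [:: S3] \in N by apply: N_gen.
have Nt : ev [:: T3] \in N by apply: N_gen.
have Nsts : ev [:: S3; T2; S3] \in N by apply: N_gen.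
have Nw : ev w0_word \in N by apply: N_gen.
have Nwi : ev w0i_word \in N by apply: N_gen.
have core m p : all (low 2) p -> m \in cs -> ev (S3 :: p ++ m) \in N.
  move=> pl mc; rewrite mem_cat in mc; case/orP: mc => mc; last first.
    have [cw cwi] := low2_comm pl.
    rewrite !inE in mc; case/orP: mc => /eqP ->;
      rewrite ev_cons (cw, cwi) -ev_cons -cat_cons.
      by apply: (mem_r N_l N_r) => //; apply: s3w0_in.
    by apply: (mem_r N_l N_r) => //; apply: s3w0i_in.
  rewrite -cat1s !ev_cat mulrA; apply: wspan_ind (low2_span pl).
  move=> r w v ul wc vl.
  (* In s3 r w v m, the factor r in u1 leaves on the left through s3; v leaves on the right when [m]
     is 1, s3 or t3. *)
  have [cs3 _] := low1_comm ul; have [vs3 vt3] := low1_comm vl.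
  rewrite catA cat1s ev_cat -cs3 -ev_cat -catA.
  have ul2 : all (low 2) r by apply: sub_all ul => -[[|[|]] []].
  have vl2 : all (low 2) v by apply: sub_all vl => -[[|[|]] []].
  suff : ev (S3 :: w ++ v ++ m) \in N.
    by move=> *; rewrite -[X in r ++ X]cats0; apply: (mem_lr N_l N_r).
  have simple q : q \in [:: [::]; [:: S3]; [:: T3]] -> ev (v ++ q) = ev (q ++ v) ->
      ev (S3 :: w ++ v ++ q) \in N.
    move=> qc vq; rewrite -cat1s 2!ev_cat vq -!ev_cat !catA.
    by apply: (mem_r N_l N_r) => //; apply: (s3_core_in N_l N_r).
  rewrite !inE in mc; case/or4P: mc => /eqP ->.
  - by apply: simple; rewrite ?cats0.
  - exact: simple.
  - exact: simple.
  (* v does not commute with s3 t2 s3; it is reduced to 1, s1 or t1 instead. *)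
  rewrite -cat_cons !ev_cat mulrA; apply: wspan_ind (low1_span vl).
  move=> ? t ? /low0_nil-> tc /low0_nil->.
  exact: (s3_core_s3t2s3_in N_l N_r).
have {}N_l x y : low 3 x -> y \in N -> g x * y \in N.
  case: x => [[|[|[|[|i]]]] e] // _; [exact: N_l | exact: N_l |].
  suff Ns3 z : z \in N -> g S3 * z \in N.
    by case: e; [apply: Ns3 | apply: (@submod_inv N 3)].
  rewrite -[_ * z]mulr1 -(ev_nil g) -(ev1 g S3).
  apply: wspan_ind => p m q pl mc ql; rewrite cats0 !catA.
  by apply: (mem_r N_l N_r) => //; apply: (core m p).
elim: u => [//|x u IHu] /= /andP[xl ul].
by rewrite ev_cons; apply/N_l/IHu.
Qed.

End CubicQuotient.

(** * Symmetry under inversion of the generators *)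

Lemma Q_relator_inv (R : comUnitRingType) (A : algType R) (a : R) (s1 s2 t1 t2 : A) :
  a \is a GRing.unit ->
  Q_relator a^-1 t1 t2 s1 s2 = a^-1 ^+ 2 *: Q_relator a s1 s2 t1 t2.
Proof.
move=> ua; have e : a^-1 * a = 1 by rewrite mulVr.
rewrite /Q_relator invrK; move: (a^-1) e => d e.
have e1 : d ^+ 2 * a = d by rewrite expr2 -mulrA e mulr1.
have e2 : d ^+ 2 * a ^+ 2 = 1 by rewrite -exprMn e expr1n.
have e3 : d ^+ 2 * a ^+ 3 = a by rewrite exprS mulrCA e2 mulr1.
rewrite !opprD !opprK !addrA !(scalerDr, scalerN) !scalerA e1 e2 e3 -exprSr !scale1r.
rewrite [RHS](ACl (12*11*6*5*4*3*10*9*8*7*2*1))%AC /=.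
by [].
Qed.

Lemma cubic_gens_inv (R : comUnitRingType) (A : algType R) (al be ga a : R)
    (g : letter -> A) :
  cubic_gens al be ga a g ->
  cubic_gens (- (ga^-1 * be)) (- (ga^-1 * al)) ga^-1 a^-1 (g \o letter_inv).
Proof.
move=> gP; split; rewrite ?unitrV.
- exact/braid_gens_inv/(cubic_braid gP).
- exact: (cubic_ga gP).
- exact: (cubic_a gP).
- rewrite /= (gen_inv gP (i := 1)) // !scalerBr !scalerA !scaleNr.
  by rewrite addrAC -addrA addrC.
- by rewrite /= Q_relator_inv ?(cubic_a gP) // (cubic_rel gP) scaler0.
Qed.

(** * The decomposition *)

Section Decomposition.
Variables (R : comUnitRingType) (A : algType R) (al be ga a : R).
Variable g : letter -> A.
Hypothesis gP : cubic_gens al be ga a g.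

Notation ev := (ev g).
Let gB := cubic_braid gP.
Let K : submodClosed A := wspan g 2 cores0.

Let K_l x y : low 2 x -> y \in K -> g x * y \in K.
Proof. exact: wspan_l. Qed.

Let K_r x y : low 2 x -> y \in K -> y * g x \in K.
Proof. exact: wspan_r. Qed.

Let K_core w : w \in cores0 -> ev w \in K.
Proof. by move=> wc; rewrite -[w]cats0; apply: (@wspan_gen _ _ _ 2 _ [::]). Qed.

Lemma w0i_eigen : ev (S1 :: w0i_word) - a *: ev w0i_word \in K.
Proof. exact: (w0_inv_eigen gP K_l K_r (K_core _) (K_core _) (K_core _) (K_core _)). Qed.

Lemma w0_eigen : ev (T1 :: w0_word) - a^-1 *: ev w0_word \in K.
Proof.
have gP' := cubic_gens_inv gP.
have K_l' x y : low 2 x -> y \in K -> (g \o letter_inv) x * y \in K.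
  by case: x => i e x2; apply: K_l.
have K_r' x y : low 2 x -> y \in K -> y * (g \o letter_inv) x \in K.
  by case: x => i e x2; apply: K_r.
have := w0_inv_eigen gP' K_l' K_r'; rewrite !ev_inv; apply; try exact: K_core.
(* Inversion turns the core s3 t2 s3 into t3 s2 t3, which is not itself a core. *)
by apply: (t3s2t3_in gP K_l K_r); apply: K_core.
Qed.

(** Conjugation by s1 s2 fixes [w] and turns s1 into s2, so both have the same eigenvalue; inverse
    letters have the inverse one, and words act by products. *)
Lemma eigen_span (w : word) e0 k :
    k \is a GRing.unit ->
    [&& word_eq ([:: S1; S2; S1] ++ w ++ [:: T2; T1]) (S2 :: w)
      & word_eq ([:: S1; S2] ++ w ++ [:: T2; T1]) w] ->
    ev ((1%N, e0) :: w) - k *: ev w \in K ->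
  forall u, all (low 2) u -> exists l, ev (u ++ w) - l *: ev w \in K.
Proof.
move=> uk /andP[/(word_eqP gB) w1 /(word_eqP gB) w2] Kx.
have einv y l : low 2 y -> l \is a GRing.unit -> ev (y :: w) - l *: ev w \in K ->
    ev (letter_inv y :: w) - l^-1 *: ev w \in K.
  move=> y2 ul Ky.
  have -> : ev (letter_inv y :: w) - l^-1 *: ev w =
      - (l^-1 *: (g (letter_inv y) * (ev (y :: w) - l *: ev w))).
    rewrite mulrBr !ev_cons mulrA (gens_invl gB) mul1r scalerBr opprB.
    by rewrite -scalerAr scalerA mulVr // scale1r.
  by rewrite submod_rpredN // rpredZ // K_l //; case: y y2 {Ky}.
have e1 e : exists2 l, l \is a GRing.unit & ev ((1%N, e) :: w) - l *: ev w \in K.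
  have [<-|ne] := eqVneq e0 e; first by exists k.
  exists k^-1; rewrite ?unitrV //.
  have -> : (1%N, e) = letter_inv (1%N, e0) by case: (e) (e0) ne => -[].
  exact: einv.
have e2 e : exists l, ev ((2%N, e) :: w) - l *: ev w \in K.
  have [l ul Kl] := e1 true.
  have Ks : ev (S2 :: w) - l *: ev w \in K.
    have -> : ev (S2 :: w) - l *: ev w =
        ev [:: S1; S2] * (ev (S1 :: w) - l *: ev w) * ev [:: T2; T1].
      by rewrite mulrBr mulrBl -scalerAr -scalerAl -!ev_cat /= w1 w2.
    move: (_ - _) Kl => z Kz; rewrite !ev_cons !ev_nil !mulr1 -!mulrA.
    by do 2!apply: K_l => //; rewrite mulrA; do 2!apply: K_r => //.
  by case: e; [exists l | exists l^-1; apply: (einv S2)].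
have ex y : low 2 y -> exists l, ev (y :: w) - l *: ev w \in K.
  case: y => [[|[|[|i]]] e] // _.
  by have [l _ Kl] := e1 e; exists l.
elim=> [_|y u IHu] /=; first by exists 1; rewrite scale1r subrr rpred0.
move=> /andP[yl /IHu[l Kl]]; have [m Km] := ex y yl; exists (l * m).
have -> : ev (y :: u ++ w) - (l * m) *: ev w =
    g y * (ev (u ++ w) - l *: ev w) + l *: (ev (y :: w) - m *: ev w).
  by rewrite mulrBr scalerBr -scalerAr scalerA !ev_cons addrA subrK.
by rewrite rpredD ?rpredZ ?K_l.
Qed.

Lemma word_decomp u : all (low 3) u -> exists k l,
  ev u - k *: ev w0_word - l *: ev w0i_word \in K.
Proof.
move=> /(word_span gP) /asboolP.
elim=> [|k x y Sx _ [k1 [l1 IH]]].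
  by exists 0, 0; rewrite !scale0r !subr0 rpred0.
suff [k0 [l0 Kx]] : exists k l, x - k *: ev w0_word - l *: ev w0i_word \in K.
  exists (k * k0 + k1), (k * l0 + l1).
  have -> : k *: x + y - (k * k0 + k1) *: ev w0_word - (k * l0 + l1) *: ev w0i_word
     = k *: (x - k0 *: ev w0_word - l0 *: ev w0i_word)
       + (y - k1 *: ev w0_word - l1 *: ev w0i_word).
    by rewrite !scalerBr !scalerA !scalerDl !opprD [RHS]addrACA -[in RHS](addrACA _ y).
  by rewrite rpredD ?rpredZ.
move: Sx => [p [w [v [pl wc vl ->]]]].
(* The right factor [v] is moved through w0 or w0^-1 to join [p] on the left. *)
have [c0 ci] := low2_comm gP vl; have pv : all (low 2) (p ++ v) by rewrite all_cat pl.
rewrite mem_cat in wc; case/orP: wc => wc.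
  by exists 0, 0; rewrite !scale0r !subr0; apply: wspan_gen.
rewrite !inE in wc; case/orP: wc => /eqP ->.
  have [l Kl] : exists l, ev ((p ++ v) ++ w0_word) - l *: ev w0_word \in K.
    by apply: (eigen_span _ _ w0_eigen) => //; rewrite unitrV (cubic_a gP).
  exists l, 0; rewrite scale0r subr0.
  by rewrite ev_cat -c0 -ev_cat catA.
have [l Kl] : exists l, ev ((p ++ v) ++ w0i_word) - l *: ev w0i_word \in K.
  by apply: (eigen_span _ _ w0i_eigen) => //; rewrite (cubic_a gP).
exists 0, l; rewrite scale0r subr0.
by rewrite ev_cat -ci -ev_cat catA.
Qed.

Let P : set A := subalg [set g S1; g S2].
Let PyP (y : A) : set A := Rspan [set x * y * z | x in P & z in P].
Let line (y : A) : set A := [set r *: y | r in [set: R]].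

Lemma low2_subalg u : all (low 2) u -> P (ev u).
Proof.
have [P0 PD] := subalg_linear [set g S1; g S2].
have Ps i : low 2 (i, true) -> P (g (i, true)).
  by case: i => [|[|[|i]]] // _; apply: subalg_gen; [left | right].
have Pt i : low 2 (i, false) -> P (g (i, false)).
  move=> i2; rewrite (gen_inv gP (i := i)); last by case: i i2 => [|[|[|i]]].
  rewrite -[X in P X]addr0; apply: (PD) => //.
  rewrite addrC -scaleNr; apply: (PD); first exact: subalg1.
  rewrite addrC -scaleNr; apply: (PD); first exact: Ps.
  by apply: subalgM; exact: Ps.
elim: u => [_|[i e] u IHu /= /andP[i2 /IHu Pu]].
  by rewrite ev_nil; exact: subalg1.
by rewrite ev_cons; apply: subalgM => //; case: e i2 => i2; [exact: Ps | exact: Pt].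
Qed.

Lemma wspan_cores0 : [set x | x \in K] `<=`
  P :+: PyP (g S3) :+: PyP (g T3) :+: PyP (ev [:: S3; T2; S3]).
Proof.
have P0 : P 0 := (subalg_linear _).1.
have R0 z : PyP z 0 by exact: Rspan0.
set U := (X in _ `<=` X); have lU : linear_set U.
  by do 3![apply: sumset_linear; last exact: Rspan_linear]; exact: subalg_linear.
move=> x /asboolP; move: x; apply: Rspan_min => // _ [u [w [v [ul wc vl ->]]]].
have Pu := low2_subalg ul; have Pv := low2_subalg vl.
have R1 : PyP (ev w) (ev (u ++ w ++ v)).
  apply: Rspan_gen; exists (ev u) => //; exists (ev v) => //.
  by rewrite -mulrA -!ev_cat.
have inl (B C : set A) y : C 0 -> B y -> (B :+: C) y.
  by move=> C0 By; exists y => //; exists 0; rewrite ?addr0.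
have inr (B C : set A) y : B 0 -> C y -> (B :+: C) y.
  by move=> B0 Cy; exists 0 => //; exists y; rewrite ?add0r.
rewrite !inE in wc; case/or4P: wc R1 => /eqP -> R1.
- do 3![apply: (inl); first exact: R0].
  by rewrite ev_cat; exact: subalgM.
- do 2![apply: (inl); first exact: R0].
  by apply: (inr) => //; rewrite -ev1.
- apply: (inl); first exact: R0.
  by apply: (inr); [apply: (inl) | rewrite -ev1].
- by apply: (inr); first by do 2![apply: (inl); first exact: R0].
Qed.

Lemma word_in_sum u : all (low 3) u ->
  (P :+: PyP (g S3) :+: PyP (g T3) :+: PyP (ev [:: S3; T2; S3])
     :+: line (ev w0_word) :+: line (ev w0i_word)) (ev u).
Proof.
move=> /word_decomp[k [l /wspan_cores0 Um]].
exists (ev u - l *: ev w0i_word).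
  exists (ev u - k *: ev w0_word - l *: ev w0i_word) => //.
  exists (k *: ev w0_word); first by exists k.
  by rewrite addrAC subrK.
by exists (l *: ev w0i_word); [exists l | rewrite subrK].
Qed.

Lemma sum_linear : linear_set
  (P :+: PyP (g S3) :+: PyP (g T3) :+: PyP (ev [:: S3; T2; S3])
     :+: line (ev w0_word) :+: line (ev w0i_word)).
Proof.
have lL (y : A) : linear_set (line y).
  split=> [|k _ _ [r _ <-] [s _ <-]]; first by exists 0; rewrite ?scale0r.
  by exists (k * r + s) => //; rewrite scalerDl scalerA.
do 5![apply: sumset_linear; last by [exact: Rspan_linear | exact: lL]].
exact: subalg_linear.
Qed.

End Decomposition.

(** Multiply (s - a)(s - b)(s - c) = 0 by t^2 on the right and expand. *)
Lemma cubic_relator_solve (R : comUnitRingType) (A : algType R) (a b c : R)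
    (s t : A) : s * t = 1 -> cubic_relator a b c s = 0 ->
  s = (a + b + c)%:A + - (a * b + b * c + c * a) *: t + (a * b * c) *: (t * t).
Proof.
move=> st /(congr1 (fun x => x * (t * t))) /=; rewrite mul0r => e.
have h1 : (s - c%:A) * (t * t) = t - c *: (t * t).
  by rewrite mulrBl mulr_algl mulrA st mul1r.
have s1 : s * (t - c *: (t * t)) = 1 - c *: t.
  by rewrite mulrBr -scalerAr mulrA st mul1r.
have h2 : (s - b%:A) * (t - c *: (t * t)) = 1 - c *: t - b *: (t - c *: (t * t)).
  by rewrite mulrBl mulr_algl s1.
have h3 : (s - a%:A) * (1 - c *: t - b *: (t - c *: (t * t))) =
    s - c%:A - b *: (1 - c *: t) - a *: (1 - c *: t - b *: (t - c *: (t * t))).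
  by rewrite mulrBl mulr_algl !mulrBr mulr1 -!scalerAr s1 st.
move: e; rewrite /cubic_relator -!mulrA h1 h2 h3 => e.
apply/eqP; rewrite -subr_eq0 -e; apply/eqP.
rewrite scaleNr !(scalerBr, scalerDl, scalerA, opprD, opprK, addrA).
rewrite (mulrC c a) (mulrA a b c).
by rewrite [RHS](ACl (1*5*3*2*7*4*6*8))%AC.
Qed.

(** * The algebra Q_4 *)

Section FourStrands.
Variables (R : comUnitRingType) (a b c : R).
Hypotheses (a_unit : a \is a GRing.unit) (b_unit : b \is a GRing.unit).
Hypothesis c_unit : c \is a GRing.unit.

Notation Q := (Qalg b c a_unit (isT : 2 < 4)%N).
Notation br := (Qbr b c a_unit (isT : 2 < 4)%N).

Local Arguments artin : simpl never.

Definition braid_letter (x : letter) : braid 4 :=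
  if x.2 then artin 4 x.1 else (artin 4 x.1)^-1%g.

Definition Q_gen (x : letter) : Q := br (braid_letter x).

Lemma artinE i (i3 : (i < 3)%N) :
  artin 4 i.+1 = (\pi_(braid 4) [:: (Ordinal i3, true)])%qT.
Proof. by rewrite /artin insubT. Qed.

Lemma Q_gen_braid : braid_gens Q_gen.
Proof.
split=> [[i e]|i i2|]; rewrite /Q_gen -!QbrM.
- by rewrite -(Qbr1 b c a_unit); congr br; case: e; rewrite ?mulgV ?mulVg.
- congr br; rewrite /braid_letter /=.
  have i3 := ltnW i2; rewrite (@artinE i) // (@artinE i.+1).
  by rewrite -![(_ * _)%g]/(braid_mul _ _) -!braid_piM; apply/braid_piP/braid_eq_near.
congr br; rewrite /braid_letter /= (@artinE 0) // (@artinE 2) //.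
by rewrite -![(_ * _)%g]/(braid_mul _ _) -!braid_piM; apply/braid_piP/braid_eq_far.
Qed.

Lemma Q_gen_cubic :
  cubic_gens (a + b + c) (- (a * b + b * c + c * a)) (a * b * c) a Q_gen.
Proof.
have [r1 r2] := Qbr_relators b c a_unit (isT : 2 < 4)%N.
split; first exact: Q_gen_braid.
- by rewrite !unitrM a_unit b_unit.
- exact: a_unit.
- by apply: cubic_relator_solve r1; exact: (gens_inv Q_gen_braid S1).
exact: r2.
Qed.

Lemma ev_Q_gen w :
  ev Q_gen w = br (foldr (fun x h => braid_letter x * h)%g 1%g w).
Proof.
by elim: w => [|x w IHw]; rewrite ?ev_nil ?Qbr1 // ev_cons IHw -QbrM.
Qed.

(** Passes from the letters of [braid_eq], indexed from 0, to letters indexed from 1. *)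
Lemma br_word (u : seq ('I_3 * bool)) :
  br (\pi_(braid 4) u)%qT = ev Q_gen [seq ((val x.1).+1, x.2) | x <- u].
Proof.
rewrite ev_Q_gen; congr br; elim: u => [//|[i e] u IHu].
rewrite -cat1s braid_piM; change (braid_mul ?x ?y) with (x * y)%g.
rewrite IHu; congr (_ * _)%g.
rewrite /braid_letter /= (@artinE i) //.
have -> : Ordinal (ltn_ord i) = i by apply: val_inj.
by case: e => //; rewrite -[RHS]braid_piV.
Qed.

(** Elements of Q_4 are linear combinations of braids, and a braid is the class of a word. *)
Lemma Q_span (T : set Q) : linear_set T ->
  (forall u, all (low 3) u -> T (ev Q_gen u)) -> forall x, T x.
Proof.
move=> [T0 TD] Tw.
have Tbr (h : braid 4) : T (br h).
  elim/quotW: h => u; rewrite br_word; apply: Tw.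
  by rewrite all_map; apply/allP => -[i e] _ /=; exact: (ltn_ord i).
apply: (qpiW (P := T)) => y; rewrite (galgE y).
apply: (big_ind (fun z => T (qpi _ z))); first by rewrite qpi0.
  by move=> z t Tz Tt; rewrite qpiD -[X in T (X + _)](scale1r (_ : Q)); apply: TD.
move=> h _; rewrite qpiZ -[X in T X](addr0 (_ : Q)).
by apply: (TD _ (br h)).
Qed.

Lemma Q_decomposition :
  let s1 := artin 4 1 in
  let s2 := artin 4 2 in
  let s3 := artin 4 3 in
  let w0 := (s3 * s2 * s1 ^+ 2 * s2 * s3)%g in
  let P : set Q := subalg [set br s1; br s2] in
  let PyP y : set Q := Rspan [set x * y * z | x in P & z in P] in
  let line y : set Q := [set r *: y | r in [set: R]] in
  [set: Q] = P :+: PyP (br s3) :+: PyP (br s3^-1%g)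
               :+: PyP (br (s3 * s2^-1 * s3)%g) :+: line (br w0) :+: line (br w0^-1%g).
Proof.
move=> s1 s2 s3 w0 P PyP line; apply/seteqP; split=> // x _.
have -> : br w0 = ev Q_gen w0_word.
  by rewrite ev_Q_gen /=; congr br; rewrite /w0 expgS expg1 mulg1 !mulgA.
have -> : br w0^-1%g = ev Q_gen w0i_word.
  by rewrite ev_Q_gen /=; congr br; rewrite /w0 expgS expg1 mulg1 !invgM !mulgA.
have -> : br (s3 * s2^-1 * s3)%g = ev Q_gen [:: S3; T2; S3].
  by rewrite ev_Q_gen /=; congr br; rewrite mulg1 !mulgA.
apply: Q_span x; first exact: (sum_linear Q_gen).
exact: (word_in_sum Q_gen_cubic).
Qed.

End FourStrands.

Theorem proposition4p6 :
  let s1 := artin 4 1 in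
  let s2 := artin 4 2 in
  let s3 := artin 4 3 in
  let w0 := (s3 * s2 * s1 ^+ 2 * s2 * s3)%g in
  [set: Q4] =
    Q3 :+: Q3yQ3 (Q4br s3) :+: Q3yQ3 (Q4br s3^-1%g)
       :+: Q3yQ3 (Q4br (s3 * s2^-1 * s3)%g)
       :+: Rline (Q4br w0) :+: Rline (Q4br w0^-1%g).
Proof.
exact: (Q_decomposition (laurent_var_unit 0) (laurent_var_unit 1) (laurent_var_unit 2)).
Qed.
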